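(* Let $S=\mathbb{C}$ with coordinate $s$, and let $p:H\to S$ be a Hilbert field each of whose fibers $H_s=p^{-1}(s)$ is an infinite dimensional separable complex Hilbert space; write $h$ for the inner products on the fibers. Let $\varphi_j$, $j=0,1,2,\ldots$, be sections of $H$ such that for every $s\in S$ the family $\{\varphi_j(s)\}_{j\ge 0}$ is an orthonormal basis of $H_s$. Let $k:S\to\mathbb{C}$ be a complex-valued real-analytic function. Put $$\Gamma^{\infty}=\left\{\sum_{l=0}^{N}a_l\varphi_l \;:\; N<\infty,\ a_l\in C^{\infty}(S)\right\},$$ and let $\nabla$ be determined by $$\nabla_{\partial/\partial s}\varphi_j=(j+1)\,k\,\varphi_j,\qquad \nabla_{\partial/\partial\bar s}\varphi_j=-(j+1)\,\bar k\,\varphi_j\qquad (j\ge 0),$$ extended to all smooth complex vector fields and all of $\Gamma^\infty$ by $C^\infty(S)$-linearity in the vector field, additivity in the section and the Leibniz rule; that is, for $\eta=b\,\frac{\partial}{\partial s}+c\,\frac{\partial}{\partial \bar s}$ with $b,c\in C^\infty(S)$, $$\nabla_\eta\Big(\sum_{l=0}^N a_l\varphi_l\Big)=\sum_{l=0}^N\big(\eta a_l+(l+1)(bk-c\bar k)a_l\big)\varphi_l .$$ Then $(\Gamma^\infty,\nabla)$ is a smooth structure on $H\to S$ for which the following hold. (1) Every section $\varphi_j$, $j\ge 0$, is analytic, and consequently the Hilbert field $H\to S$ is analytic. (2) If moreover $k=\frac{\partial g}{\partial s}$, where $g:S\to\mathbb{R}$ is a real-valued, real-analytic, non-harmonic function,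 then this Hilbert field $H\to S$ (with smooth structure $(\Gamma^\infty,\nabla)$) is not induced from any hermitian Hilbert bundle.
   Context: Functions in $C^\infty(S)$ are complex valued. $\mathrm{Vect}\,S$ denotes the set of smooth complex-valued vector fields on $S$. Inner products are complex linear in the first argument and conjugate linear in the second. **Hilbert field.** A Hilbert field is a map of sets $p:H\to S$ with a Hilbert space structure on each fiber $H_s=p^{-1}(s)$. For sections $\varphi,\psi$ of $H$, $h(\varphi,\psi)$ is the function $s\mapsto\langle\varphi(s),\psi(s)\rangle_{H_s}$, and $h(\varphi)=h(\varphi,\varphi)$. **Smooth structure.** Let $S$ be a smooth manifold and $H\to S$ a Hilbert field. A smooth structure on $H$ is a pair $(\Gamma^\infty,\nabla)$, where $\Gamma^\infty$ is a set of sections of $H$ closed under addition and under multiplication by elements of $C^\infty(S)$, and $\nabla$ assigns to each $\xi\in\mathrm{Vect}\,S$ a linear operator $\nabla_\xi:\Gamma^\infty\to\Gamma^\infty$, such that for all $\xi,\eta\in\mathrm{Vect}\,S$, $f\in C^\infty(S)$, $\varphi,\psi\in\Gamma^\infty$: (i) $\nabla_{\xi+\eta}\varphi=\nabla_\xi\varphi+\nabla_\eta\varphi$, $\nabla_{f\xi}\varphi=f\nabla_\xi\varphi$, $\nabla_\xi(f\varphi)=(\xi f)\varphi+f\nabla_\xi\varphi$; (ii) $h(\varphi,\psi)\in C^\infty(S)$ and $\xi h(\varphi,\psi)=h(\nabla_\xi\varphi,\psi)+h(\varphi,\nabla_{\bar\xi}\psi)$; (iii) $\{\varphi(s):\varphi\in\Gamma^\infty\}$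 is dense in $H_s$ for all $s\in S$. **Analytic sections and analytic Hilbert fields.** Let $S$ be a finite dimensional real-analytic manifold and $H\to S$ a Hilbert field with smooth structure $(\Gamma^\infty,\nabla)$. A section $\varphi\in\Gamma^\infty$ is analytic if for every compact $C\subset S$ and every finite set $\Xi\subset\mathrm{Vect}\,S$ all of whose elements are analytic in a neighborhood of $C$, there is an $\epsilon>0$ such that $$\sup\ \frac{\epsilon^m}{m!}\,h(\nabla_{\xi_m}\cdots\nabla_{\xi_1}\varphi)^{1/2}(s)<\infty,$$ the supremum being over $m=0,1,2,\ldots$, $\xi_1,\ldots,\xi_m\in\Xi$ and $s\in C$. Let $\Gamma^\omega$ be the set of analytic sections. The Hilbert field is analytic if $\{\varphi(s):\varphi\in\Gamma^\omega\}$ is dense in $H_s$ for all $s\in S$. **Hermitian Hilbert bundle.** A (smooth) Banach manifold is a Hausdorff space with an atlas of charts onto open subsets of Banach spaces with smooth transition maps; smooth maps between Banach manifolds are those that are smooth in charts. A smooth Hilbert bundle is a smooth map $\pi:\tilde H\to S$ of Banach manifolds, each fiber $\pi^{-1}(s)$ being endowed with a complex vector space structure, such that each $s\in S$ has an open neighborhood $U\subset S$, a complex Hilbert space $X_U$ and a smooth map $F_U:\pi^{-1}(U)\to X_U$ that is linear on each fiber over $U$ and such that $\pi\times F_U:\pi^{-1}(U)\to U\times X_U$ is a diffeomorphism (such $F_U$ is called a local trivialization). $\Gamma^\infty(S,\tilde H)$ denotes its smooth sections. A smooth hermitian metric on it is a function $\tilde h:\tilde H\oplus\tilde H\to\mathbb{C}$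 such that the local trivializations above can be chosen with $\tilde h(u,v)=\langle F_U(u),F_U(v)\rangle_{X_U}$ for $u,v$ in the same fiber. The pair $(\tilde H,\tilde h)\to S$ is a hermitian Hilbert bundle. **Hermitian connection.** A connection $\tilde\nabla$ on a smooth Hilbert bundle $\tilde H\to S$ assigns to each $\xi\in\mathrm{Vect}\,S$ a linear map $\tilde\nabla_\xi:\Gamma^\infty(S,\tilde H)\to\Gamma^\infty(S,\tilde H)$, such that for every local trivialization $F_U:\pi^{-1}(U)\to X_U$ there is a smooth map $A:\mathbb{C}\otimes TU\to U\times\mathrm{End}\,X_U$ ($\mathrm{End}\,X_U$ being the Banach space of bounded operators), mapping fibers to fibers and linear on each $\mathbb{C}\otimes T_sU$, with $F_U(\tilde\nabla_\xi\varphi)=\xi F_U(\varphi)+A(\xi)F_U(\varphi)$ on $U$ for all $\varphi\in\Gamma^\infty(S,\tilde H)$. For a hermitian Hilbert bundle $(\tilde H,\tilde h)$, the connection is hermitian if $\xi\tilde h(\varphi,\psi)=\tilde h(\tilde\nabla_\xi\varphi,\psi)+\tilde h(\varphi,\tilde\nabla_{\bar\xi}\psi)$ for all $\xi\in\mathrm{Vect}\,S$ and all smooth sections $\varphi,\psi$. **Being induced from a hermitian Hilbert bundle.** A Hilbert field $H\to S$ with smooth structure $(\Gamma^\infty,\nabla)$ is induced from a hermitian Hilbert bundle $(\tilde H,\tilde h)\to S$ with hermitian connection $\tilde\nabla$ if there is a fiber preserving map $F:H\to\tilde H$ such that $F|_{H_s}$ is an isometric linear map into $\tilde H_s$ for all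 $s\in S$, $F\varphi\in\Gamma^\infty(S,\tilde H)$ for all $\varphi\in\Gamma^\infty$, and $\tilde\nabla_\xi(F\varphi)=F(\nabla_\xi\varphi)$ for all $\varphi\in\Gamma^\infty$ and $\xi\in\mathrm{Vect}\,S$. ''Not induced from any hermitian Hilbert bundle'' means that no such $(\tilde H,\tilde h)$, $\tilde\nabla$, $F$ exist. *)

(* Defs.v *)
From HB Require Import structures.
From mathcomp Require Import all_boot all_order all_algebra sesquilinear.
From mathcomp Require Import complex lra.
From mathcomp Require Import all_classical all_reals topology normedtype derive.

Set Implicit Arguments.
Unset Strict Implicit.
Unset Printing Implicit Defensive.

Import Order.TTheory GRing.Theory Num.Theory.
Import numFieldNormedType.Exports.

Local Open Scope classical_set_scope.
Local Open Scope ring_scope.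
Local Open Scope complex_scope.

Section Rcomplex_normed.
Context {R : realType}.

HB.instance Definition _ :=
  PseudoMetric.copy (Rcomplex R) (pseudoMetric_normed (Rcomplex R)).
HB.instance Definition _ := isPointed.Build (Rcomplex R) 0.
HB.instance Definition _ := NormedZmod_PseudoMetric_eq.Build R (Rcomplex R) erefl.

Fact Rcomplex_normrZ (l : R) (x : Rcomplex R) : `|l *: x| = `|l| * `|x|.
Proof.
case: x => a b; rewrite /Num.norm /= !exprMn -mulrDr sqrtrM ?sqr_ge0//.
by rewrite sqrtr_sqr.
Qed.

HB.instance Definition _ :=
  PseudoMetricNormedZmod_Lmodule_isNormedModule.Build R (Rcomplex R) Rcomplex_normrZ.

Fact Re_le_norm (x : Rcomplex R) : `|complex.Re x| <= `|x|.
Proof.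
by case: x => a b /=; rewrite -sqrtr_sqr ler_wsqrtr// lerDl sqr_ge0.
Qed.

Fact Im_le_norm (x : Rcomplex R) : `|complex.Im x| <= `|x|.
Proof.
by case: x => a b /=; rewrite -sqrtr_sqr ler_wsqrtr// lerDr sqr_ge0.
Qed.

Fact norm_le_ReIm (x : Rcomplex R) : `|x| <= `|complex.Re x| + `|complex.Im x|.
Proof.
case: x => a b /=; rewrite -[leRHS]ger0_norm ?addr_ge0// -[leRHS]sqrtr_sqr.
rewrite ler_wsqrtr// sqrrD !real_normK ?num_real// -addrA [_ *+ 2 + _]addrC addrA.
by rewrite lerDl mulrn_wge0// mulr_ge0.
Qed.

Fact Rcomplex_complete (F : set_system (Rcomplex R)) :
  ProperFilter F -> cauchy F -> cvg F.
Proof.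
move=> FF /cauchy_ballP Fc.
have cauchy_comp (p : Rcomplex R -> R) :
    (forall x y, `|p x - p y| <= `|x - y|) -> cvg (p @ F).
  move=> lp; apply: cauchy_cvg; apply/cauchy_ballP => e e0.
  case: (Fc e e0) => -[A B] /= [FA FB] AB.
  exists (p @` A, p @` B) => /=.
    split; first by apply: filterS FA => x Ax; exists x.
    by apply: filterS FB => x Bx; exists x.
  move=> [_ _] /= [[x Ax <-] [y By <-]].
  have := AB (x, y) (conj Ax By).
  by rewrite -!ball_normE /=; exact: le_lt_trans.
have cR : cvg ((fun x : Rcomplex R => complex.Re x) @ F).
  by apply: cauchy_comp => x y; rewrite -raddfB; exact: Re_le_norm.
have cI : cvg ((fun x : Rcomplex R => complex.Im x) @ F).
  by apply: cauchy_comp => x y; rewrite -raddfB; exact: Im_le_norm.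
apply/cvg_ex.
exists (Complex (lim ((fun x : Rcomplex R => complex.Re x) @ F))
                (lim ((fun x : Rcomplex R => complex.Im x) @ F)) : Rcomplex R).
apply/cvgrPdist_lt => e e0; have e20 : 0 < e / 2 by rewrite divr_gt0.
have /cvgrPdist_lt/(_ _ e20) nR := cR; have /cvgrPdist_lt/(_ _ e20) nI := cI.
near=> x; rewrite (le_lt_trans (norm_le_ReIm _))// (splitr e) ltrD//.
  by rewrite raddfB /=; near: x.
by rewrite raddfB /=; near: x.
Unshelve. all: by end_near. Qed.

HB.instance Definition _ := Uniform_isComplete.Build (Rcomplex R) Rcomplex_complete.

End Rcomplex_normed.

HB.saturate prod.

Section prod_complete.
Context {R : realType} {E F : completeNormedModType R}.

Fact prod_complete (G : set_system (E * F)%type) :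
  ProperFilter G -> cauchy G -> cvg G.
Proof.
move=> FG /cauchy_ballP Gc.
have c1 : cvg ((@fst E F) @ G).
  apply: cauchy_cvg; apply/cauchy_ballP => e e0.
  case: (Gc e e0) => -[A B] /= [GA GB] AB.
  exists (fst @` A, fst @` B) => /=.
    split; first by apply: filterS GA => x Ax; exists x.
    by apply: filterS GB => x Bx; exists x.
  by move=> [_ _] /= [[x Ax <-] [y By <-]]; case: (AB (x, y) (conj Ax By)).
have c2 : cvg ((@snd E F) @ G).
  apply: cauchy_cvg; apply/cauchy_ballP => e e0.
  case: (Gc e e0) => -[A B] /= [GA GB] AB.
  exists (snd @` A, snd @` B) => /=.
    split; first by apply: filterS GA => x Ax; exists x.
    by apply: filterS GB => x Bx; exists x.
  by move=> [_ _] /= [[x Ax <-] [y By <-]]; case: (AB (x, y) (conj Ax By)).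
apply/cvg_ex; exists (lim (fst @ G), lim (snd @ G)).
rewrite -[G](_ : (fun x => (x.1, x.2)) @ G = G); first exact: cvg_pair.
rewrite (_ : (fun x => (x.1, x.2)) = id) ?fmap_id//.
by apply/funext => -[].
Qed.

HB.instance Definition _ := Uniform_isComplete.Build (E * F)%type prod_complete.

End prod_complete.

Section bounded_operators.
Context {R : realType} (E F : normedModType R).

Definition continuous_linear : {pred E -> F} :=
  fun f => `[< linear f /\ continuous f >].

Record bounded_operator := BoundedOperator {
  operator_fun :> E -> F ;
  _ : operator_fun \in continuous_linear }.

HB.instance Definition _ := [isSub for operator_fun].
HB.instance Definition _ := gen_eqMixin bounded_operator.
HB.instance Definition _ := gen_choiceMixin bounded_operator.

Fact continuous_linear_submod : submod_closed continuous_linear.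
Proof.
split.
  apply/asboolP; split => [a x y|x]; last exact: cvg_cst.
  by rewrite scaler0 addr0.
move=> a f g /asboolP[lf cf] /asboolP[lg cg]; apply/asboolP; split.
  move=> b x y; rewrite !fctE lf lg !scalerDr !scalerA (mulrC b a).
  by rewrite addrACA.
move=> x; apply: cvgD; last exact: cg.
by apply: cvgZl_tmp; exact: cf.
Qed.

HB.instance Definition _ :=
  GRing.isSubmodClosed.Build R (E -> F) continuous_linear continuous_linear_submod.
HB.instance Definition _ := [SubChoice_isSubLmodule of bounded_operator by <:].

Fact bounded_operator_linear (f : bounded_operator) : linear f.
Proof. by case: f => f /= /asboolP[]. Qed.

HB.instance Definition _ (f : bounded_operator) :=
  GRing.isLinear.Build R E F *:%R (operator_fun f) (bounded_operator_linear f).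

Fact bounded_operator_continuous (f : bounded_operator) : continuous f.
Proof. by case: f => f /= /asboolP[]. Qed.

Definition operator_norm (f : bounded_operator) : R :=
  sup [set `|f x| | x in [set x | `|x| <= 1]].

Fact has_sup_operator_norm (f : bounded_operator) :
  has_sup [set `|f x| | x in [set x | `|x| <= 1]].
Proof.
split; first by exists `|f 0|, 0 => //=; rewrite normr0.
have /linear_boundedP[M [_ Mf]] : bounded_near f (nbhs 0).
  by apply: continuous_linear_bounded; exact: bounded_operator_continuous.
exists (`|M| + 1) => _ [x /= x1 <-].
apply: (le_trans (Mf (`|M| + 1) _ x)).
  by rewrite (le_lt_trans (ler_norm M))// ltrDl.
by rewrite ler_piMr// addr_ge0.
Qed.

Implicit Types f g : bounded_operator.

Fact operator_norm_ge0 f : 0 <= operator_norm f.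
Proof.
apply: (le_trans (normr_ge0 (f 0))).
apply: (sup_upper_bound (has_sup_operator_norm f)).
by exists 0 => //=; rewrite normr0.
Qed.

Fact operator_normP f x : `|f x| <= operator_norm f * `|x|.
Proof.
have [->|x0] := eqVneq x 0; first by rewrite linear0 !normr0 mulr0.
have nx : 0 < `|x| by rewrite normr_gt0.
rewrite -ler_pdivrMr// mulrC -{1}[`|x|]ger0_norm// -normfV -normrZ -linearZ.
apply: (sup_upper_bound (has_sup_operator_norm f)).
exists (`|x|^-1 *: x) => //=.
by rewrite normrZ normfV normr_id mulVf// gt_eqF.
Qed.

Fact operator_norm_le f (M : R) :
  (forall x, `|x| <= 1 -> `|f x| <= M) -> operator_norm f <= M.
Proof.
move=> fM; apply: ge_sup; first by case: (has_sup_operator_norm f).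
by move=> _ [x /= x1 <-]; exact: fM.
Qed.

Fact operator_normD f g :
  operator_norm (f + g) <= operator_norm f + operator_norm g.
Proof.
apply: operator_norm_le => x x1; apply: (le_trans (ler_normD (f x) (g x))).
have le_norm h : `|operator_fun h x| <= operator_norm h.
  by apply: (le_trans (operator_normP h x)); rewrite ler_piMr// operator_norm_ge0.
exact: lerD.
Qed.

Fact operator_norm_eq0 f : operator_norm f = 0 -> f = 0.
Proof.
move=> f0; apply/val_inj/funext => x /=; apply/eqP.
by rewrite -normr_le0 (le_trans (operator_normP f x))// f0 mul0r.
Qed.

Fact operator_normZ (a : R) f : operator_norm (a *: f) = `|a| * operator_norm f.
Proof.
have leZ (b : R) g : operator_norm (b *: g) <= `|b| * operator_norm g.
  apply: operator_norm_le => x x1.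
  rewrite (_ : (b *: g) x = b *: g x)// normrZ ler_wpM2l//.
  by apply: (le_trans (operator_normP g x)); rewrite ler_piMr// operator_norm_ge0.
apply/eqP; rewrite eq_le leZ/=.
have [->|a0] := eqVneq a 0; first by rewrite normr0 mul0r operator_norm_ge0.
rewrite -ler_pdivlMl ?normr_gt0// -normfV.
by have := leZ a^-1 (a *: f); rewrite scalerA mulVf// scale1r.
Qed.

HB.instance Definition _ := Lmodule_isNormed.Build R bounded_operator
  operator_normD operator_normZ operator_norm_eq0.

End bounded_operators.

(* [inner] is linear in its first and conjugate linear in its second argument. *)
HB.mixin Record Lmodule_isPreHilbert (R : realType) V & GRing.Lmodule R[i] V := {
  inner : {dot V for Num.conj} }.

#[short(type="preHilbertType")]
HB.structure Definition PreHilbert (R : realType) :=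
  {V of GRing.Lmodule R[i] V & Lmodule_isPreHilbert R V}.

(* The real normed space underlying a complex inner product space. *)
Definition realified (R : realType) (V : preHilbertType R) : Type := V.

Section realified_normed.
Context {R : realType} (V : preHilbertType R).
Implicit Types x y : V.

HB.instance Definition _ := GRing.Zmodule.on (realified V).

Definition rscale (a : R) (x : realified V) : realified V := a%:C *: (x : V).

Fact rscaleA a b x : rscale a (rscale b x) = rscale (a * b) x.
Proof. by rewrite /rscale scalerA rmorphM. Qed.

Fact rscale1 : left_id 1 rscale.
Proof. by move=> x; rewrite /rscale rmorph1 scale1r. Qed.

Fact rscaleDr : right_distributive rscale +%R.
Proof. by move=> a x y; rewrite /rscale scalerDr. Qed.

Fact rscaleDl x : {morph rscale^~ x : a b / a + b}.
Proof. by move=> a b; rewrite /rscale rmorphD scalerDl. Qed.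

HB.instance Definition _ := GRing.Zmodule_isLmodule.Build R (realified V)
  rscaleA rscale1 rscaleDr rscaleDl.

Definition hilbert_norm (x : realified V) : R :=
  Num.sqrt (complex.Re (inner (x : V) (x : V))).

Fact inner_real x : (complex.Re (inner x x))%:C = inner x x :> R[i].
Proof. by rewrite RRe_real// ger0_real// dnorm_ge0. Qed.

Fact Re_inner_ge0 x : 0 <= complex.Re (inner x x) :> R.
Proof. by rewrite -ler0c inner_real dnorm_ge0. Qed.

Fact hilbert_norm_sqr x : hilbert_norm x ^+ 2 = complex.Re (inner x x).
Proof. by rewrite sqr_sqrtr// Re_inner_ge0. Qed.

Fact hilbert_norm_eq0 (x : realified V) : hilbert_norm x = 0 -> x = 0.
Proof.
move=> x0; apply/eqP; rewrite -(dnorm_eq0 (inner : {dot V for _})).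
by rewrite -inner_real -hilbert_norm_sqr x0 expr0n.
Qed.

Fact hilbert_normZ (a : R) (x : realified V) :
  hilbert_norm (a *: x) = `|a| * hilbert_norm x.
Proof.
rewrite /hilbert_norm -sqrtr_sqr -sqrtrM ?sqr_ge0//; congr Num.sqrt.
rewrite [a *: x]/(a%:C *: (x : V)) dnormZ real_normK ?complex_real//.
by rewrite -inner_real -rmorphXn -rmorphM.
Qed.

Fact Re_inner_le x y : complex.Re (inner x y) <= hilbert_norm x * hilbert_norm y.
Proof.
have [->|y0] := eqVneq y 0; first by rewrite linear0r /= mulr_ge0 ?sqrtr_ge0.
have [->|x0] := eqVneq x 0; first by rewrite linear0l /= mulr_ge0 ?sqrtr_ge0.
have gt0 z : z != 0 -> 0 < hilbert_norm z.
  move=> z0; rewrite lt_neqAle sqrtr_ge0 andbT eq_sym.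
  by apply: contra_neq z0; exact: hilbert_norm_eq0.
pose a := hilbert_norm x; pose b := hilbert_norm y.
have a0 : 0 < a := gt0 _ x0; have b0 : 0 < b := gt0 _ y0.
have ReD (u v : R[i]) : complex.Re (u + v) = complex.Re u + complex.Re v.
  by case: u v => ? ? [].
have ReN (u : R[i]) : complex.Re (- u) = - complex.Re u by case: u.
have Rec (u : R[i]) : complex.Re (u^*)%R = complex.Re u by case: u.
have ReM (r : R) (u : R[i]) : complex.Re (r%:C * u) = r * complex.Re u.
  by case: u => p q /=; rewrite mul0r subr0.
have := Re_inner_ge0 (b%:C *: x - a%:C *: y).
rewrite dnormB !(ReD, ReN) Rec !dnormZ !real_normK ?complex_real// -!rmorphXn !ReM.
have -> : inner (b%:C *: x) (a%:C *: y) = b%:C * (a%:C * inner x y).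
  by rewrite linearZl_LR linearZr_LR /= conj_Creal ?complex_real.
rewrite !ReM -!hilbert_norm_sqr -/a -/b.
set t := complex.Re _ => h.
have : 0 <= 2 * (a * b) * (a * b - t) by apply: le_trans h _; lra.
by rewrite pmulr_rge0 ?mulr_gt0// subr_ge0.
Qed.

Fact hilbert_normD (x y : realified V) :
  hilbert_norm (x + y) <= hilbert_norm x + hilbert_norm y.
Proof.
rewrite -(@ler_pXn2r _ 2) ?nnegrE ?addr_ge0 ?sqrtr_ge0//.
have ReD (u v : R[i]) : complex.Re (u + v) = complex.Re u + complex.Re v.
  by case: u v => ? ? [].
have Rec (u : R[i]) : complex.Re (u^*)%R = complex.Re u by case: u.
rewrite sqrrD !hilbert_norm_sqr.
rewrite (dnormD (inner : {dot V for Num.conj}) (x : V) (y : V)) !ReD Rec.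
have := Re_inner_le x y; lra.
Qed.

HB.instance Definition _ := Lmodule_isNormed.Build R (realified V)
  hilbert_normD hilbert_normZ hilbert_norm_eq0.

End realified_normed.

HB.mixin Record PreHilbert_isHilbert (R : realType) V & PreHilbert R V := {
  realified_complete : forall F : set_system (realified V),
    ProperFilter F -> cauchy F -> cvg F }.

#[short(type="hilbertType")]
HB.structure Definition Hilbert (R : realType) :=
  {V of PreHilbert R V & PreHilbert_isHilbert R V}.

HB.instance Definition _ (R : realType) (V : hilbertType R) :=
  Uniform_isComplete.Build (realified V) (@realified_complete R V).

Section smooth_maps.
Context {R : realType}.

(* [Ck n U f] is meant for [U] open: [f] is [n] times continuously Frechet
   differentiable on [U], derivatives being maps into the normed space of
   bounded operators. *)
Fixpoint Ck (n : nat) (E F : normedModType R) (U : set E) (f : E -> F) : Prop :=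
  if n is n'.+1 then
    exists df : E -> bounded_operator E F,
      (forall x, U x -> is_diff x f (df x)) /\ Ck n' U df
  else forall x, U x -> {for x, continuous f}.

Definition smooth_on (E F : normedModType R) (U : set E) (f : E -> F) : Prop :=
  forall n, Ck n U f.

Fact Ck_cst n (E F : normedModType R) (U : set E) (a : F) : Ck n U (fun=> a).
Proof.
elim: n F a => [|n IHn] F a /=; first by move=> x _; exact: cvg_cst.
exists (fun=> 0); split=> [x _|]; last exact: IHn.
exact: (is_diff_cst a x).
Qed.

Fact id_bounded (E : normedModType R) : @idfun E \in @continuous_linear R E E.
Proof. by apply/asboolP; split=> // x; exact: cvg_id. Qed.

Fact smooth_on_id (E : normedModType R) (U : set E) : smooth_on U (@id E).
Proof.
case=> [|n] /=; first by move=> x _; exact: cvg_id.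
exists (fun=> BoundedOperator (id_bounded E)); split; last exact: Ck_cst.
by move=> x _; exact: is_diff_id.
Qed.

End smooth_maps.

Section banach_manifolds.
Context {R : realType}.

Record banach_chart (M : topologicalType) := BanachChart {
  chart_model : completeNormedModType R ;
  chart_dom : set M ;
  chart_map : M -> chart_model ;
  chart_inv : chart_model -> M ;
  chart_dom_open : open chart_dom ;
  chart_im_open : open (chart_map @` chart_dom) ;
  chart_mapK : forall x, chart_dom x -> chart_inv (chart_map x) = x ;
  chart_map_continuous : forall x, chart_dom x -> {for x, continuous chart_map} ;
  chart_inv_continuous :
    forall y, (chart_map @` chart_dom) y -> {for y, continuous chart_inv} }.

Arguments chart_map {M} b.
Arguments chart_inv {M} b.

Record banach_manifold := BanachManifold {
  manifold_points :> topologicalType ;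
  manifold_hausdorff : hausdorff_space manifold_points ;
  atlas : banach_chart manifold_points -> Prop ;
  atlas_cover : forall x, exists2 c : banach_chart manifold_points, atlas c & chart_dom c x ;
  atlas_transition : forall c d, atlas c -> atlas d ->
    smooth_on (chart_map c @` (chart_dom c `&` chart_dom d))
              (chart_map d \o chart_inv c) }.

(* For [D] an open subset of [M]. *)
Definition smooth_map (M N : banach_manifold) (D : set M) (f : M -> N) : Prop :=
  (forall x, D x -> {for x, continuous f}) /\
  forall c d, atlas c -> atlas d ->
    smooth_on (chart_map c @` (chart_dom c `&` D `&` f @^-1` chart_dom d))
              (chart_map d \o f \o chart_inv c).

Definition diffeomorphism (M N : banach_manifold) (D : set M) (D' : set N)
    (f : M -> N) : Prop :=
  smooth_map D f /\
  exists g : N -> M,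
    [/\ smooth_map D' g,
        forall x, D x -> D' (f x) /\ g (f x) = x &
        forall y, D' y -> D (g y) /\ f (g y) = y].

Section banach_space_manifold.
Variable E : completeNormedModType R.

Fact id_im_open : open (@id E @` setT).
Proof. by rewrite image_id; exact: openT. Qed.

Definition id_chart : banach_chart E := @BanachChart E E setT id id openT
  id_im_open (fun x _ => erefl) (fun x _ => @cvg_id _ _) (fun x _ => @cvg_id _ _).

Fact id_atlas_cover (x : E) :
  exists2 c : banach_chart E, c = id_chart & chart_dom c x.
Proof. by exists id_chart. Qed.

Fact id_atlas_transition (c d : banach_chart E) : c = id_chart -> d = id_chart ->
  smooth_on (chart_map c @` (chart_dom c `&` chart_dom d))
            (chart_map d \o chart_inv c).
Proof. by move=> -> ->; exact: smooth_on_id. Qed.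

Definition banach_space : banach_manifold :=
  BanachManifold (@norm_hausdorff R E) id_atlas_cover id_atlas_transition.

End banach_space_manifold.

End banach_manifolds.

Section plane.
Context {R : realType}.
Local Notation C := R[i].
Local Notation S := (Rcomplex R).

Definition smooth_fun (f : S -> C) : Prop := @smooth_on R S S setT f.

(* Convergent power series expansion in the real coordinates of [S]. *)
Definition analytic_at (f : S -> C) (p : S) : Prop :=
  exists (c : nat -> nat -> S) (r : R),
  [/\ 0 < r,
      exists M : R, forall N,
        \sum_(m < N) \sum_(n < N) `|c m n| * r ^+ (m + n) <= M &
      forall x y : R, `|x| < r -> `|y| < r ->
        (fun N : nat => \sum_(m < N) \sum_(n < N) (x ^+ m * y ^+ n) *: c m n)
          @ \oo --> (f (p + (x +i* y)) : S)].

(* Derivatives of [V]-valued functions on [S], where [V] is a real normed space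
   on which the complex scalars act through [sc]. *)
Section wirtinger.
Context {V : normedModType R} (sc : C -> V -> V).
Implicit Types (f : S -> V) (p : S).

Definition d_ds_for f p : V :=
  2^-1 *: ('D_(1 : S) f p - sc 'i%C ('D_('i%C : S) f p)).

Definition d_dsbar_for f p : V :=
  2^-1 *: ('D_(1 : S) f p + sc 'i%C ('D_('i%C : S) f p)).

End wirtinger.

(* [VectorField b c] is b d/ds + c d/dsbar. *)
Record vector_field := VectorField { vf_s : S -> C ; vf_sbar : S -> C }.

Implicit Types xi eta : vector_field.

Definition smooth_vf xi : Prop := smooth_fun (vf_s xi) /\ smooth_fun (vf_sbar xi).

Definition analytic_vf_at xi (p : S) : Prop :=
  analytic_at (vf_s xi) p /\ analytic_at (vf_sbar xi) p.

Definition vf_add xi eta : vector_field :=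
  VectorField (fun s => vf_s xi s + vf_s eta s)
              (fun s => vf_sbar xi s + vf_sbar eta s).

Definition vf_scale (f : S -> C) xi : vector_field :=
  VectorField (fun s => f s * vf_s xi s) (fun s => f s * vf_sbar xi s).

Definition vf_conj xi : vector_field :=
  VectorField (fun s => conjc (vf_sbar xi s)) (fun s => conjc (vf_s xi s)).

Definition d_ds (f : S -> C) : S -> C := @d_ds_for S *%R f.

Definition d_dsbar (f : S -> C) : S -> C := @d_dsbar_for S *%R f.

Definition vf_apply xi (f : S -> C) (p : S) : C :=
  vf_s xi p * d_ds f p + vf_sbar xi p * d_dsbar f p.

Definition cscale (X : hilbertType R) (a : C) (x : realified X) : realified X :=
  a *: (x : X).

Definition vf_apply_vec (X : hilbertType R) xi (u : S -> realified X) (p : S) :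
    realified X :=
  cscale (vf_s xi p) (d_ds_for (@cscale X) u p) +
  cscale (vf_sbar xi p) (d_dsbar_for (@cscale X) u p).

Definition laplacian (g : S -> R) (p : S) : R :=
  'D_(1 : S) ('D_(1 : S) g) p + 'D_('i%C : S) ('D_('i%C : S) g) p.

Definition harmonic (g : S -> R) : Prop :=
  Ck 2 setT g /\ forall p, laplacian g p = 0.

End plane.
Arguments vector_field : clear implicits.

Section hilbert_spaces.
Context {R : realType}.

Definition infinite_dimensional (X : hilbertType R) : Prop :=
  forall n (v : 'I_n -> X), exists x : X,
    forall c : 'I_n -> R[i], x <> \sum_(i < n) c i *: v i.

Definition separable_space (T : topologicalType) : Prop :=
  exists2 D : set T, countable D & dense D.

Definition orthonormal_basis (X : hilbertType R) (e : nat -> X) : Prop :=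
  (forall i j, inner (e i) (e j) = (i == j)%:R) /\
  dense [set x : realified X |
    exists n (c : nat -> R[i]), x = \sum_(i < n) c i *: e i :> X].

End hilbert_spaces.

Section hilbert_fields.
Context {R : realType}.
Local Notation C := R[i].
Local Notation S := (Rcomplex R).
Variable H : S -> hilbertType R.

Definition hsection := forall s : S, H s.

Implicit Types (phi psi : hsection) (xi eta : vector_field R) (f : S -> C).

Definition hs_inner phi psi : S -> C := fun s => inner (phi s) (psi s).

Definition hs_add phi psi : hsection := fun s => phi s + psi s.

Definition hs_scale f phi : hsection := fun s => f s *: phi s.

Variables (Gamma : set hsection) (nabla : vector_field R -> hsection -> hsection).

(* Only the values of [nabla] on smooth vector fields and on elements of [Gamma]
   are meaningful. *)
Record smooth_structure : Prop := SmoothStructure {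
  Gamma_add : forall phi psi, Gamma phi -> Gamma psi -> Gamma (hs_add phi psi) ;
  Gamma_scale : forall f phi, smooth_fun f -> Gamma phi -> Gamma (hs_scale f phi) ;
  nabla_Gamma : forall xi phi, smooth_vf xi -> Gamma phi -> Gamma (nabla xi phi) ;
  nabla_linear : forall xi (a : C) phi psi,
    smooth_vf xi -> Gamma phi -> Gamma psi ->
    nabla xi (hs_add (hs_scale (fun=> a) phi) psi) =
    hs_add (hs_scale (fun=> a) (nabla xi phi)) (nabla xi psi) ;
  nabla_vf_add : forall xi eta phi, smooth_vf xi -> smooth_vf eta -> Gamma phi ->
    nabla (vf_add xi eta) phi = hs_add (nabla xi phi) (nabla eta phi) ;
  nabla_vf_scale : forall f xi phi, smooth_fun f -> smooth_vf xi -> Gamma phi ->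
    nabla (vf_scale f xi) phi = hs_scale f (nabla xi phi) ;
  nabla_Leibniz : forall xi f phi, smooth_vf xi -> smooth_fun f -> Gamma phi ->
    nabla xi (hs_scale f phi) =
    hs_add (hs_scale (vf_apply xi f) phi) (hs_scale f (nabla xi phi)) ;
  hs_inner_smooth : forall phi psi, Gamma phi -> Gamma psi -> smooth_fun (hs_inner phi psi) ;
  nabla_inner : forall xi phi psi s, smooth_vf xi -> Gamma phi -> Gamma psi ->
    vf_apply xi (hs_inner phi psi) s =
    hs_inner (nabla xi phi) psi s + hs_inner phi (nabla (vf_conj xi) psi) s ;
  Gamma_dense : forall s,
    dense [set (phi s : realified (H s)) | phi in Gamma] }.

Definition analytic_section phi : Prop :=
  Gamma phi /\
  forall (K : set S) (n : nat) (Xi : 'I_n -> vector_field R),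
    compact K ->
    (forall i, smooth_vf (Xi i)) ->
    (forall i, exists O : set S,
      [/\ open O, K `<=` O & forall p, O p -> analytic_vf_at (Xi i) p]) ->
    exists2 eps : R, 0 < eps &
    exists M : R, forall (w : seq 'I_n) (s : S), K s ->
      eps ^+ size w / (size w)`!%:R *
      `|foldl (fun psi i => nabla (Xi i) psi) phi w s : realified (H s)| <= M.

Definition analytic_hilbert_field : Prop :=
  forall s, dense [set (phi s : realified (H s)) | phi in analytic_section].

End hilbert_fields.

Section hilbert_bundles.
Context {R : realType}.
Local Notation C := R[i].
Local Notation S := (Rcomplex R).

(* [fiber_incl s] identifies the complex vector space [fiber s] with the fiber of [bundle_proj]
   over [s]. *)
Record vector_fibration := VectorFibration {
  total_space : @banach_manifold R ;
  bundle_proj : total_space -> S ;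
  bundle_proj_smooth : @smooth_map R total_space (banach_space S) setT bundle_proj ;
  fiber : S -> lmodType C ;
  fiber_incl : forall s, fiber s -> total_space ;
  fiber_incl_inj : forall s, injective (@fiber_incl s) ;
  fiber_incl_im : forall s, range (@fiber_incl s) = bundle_proj @^-1` [set s] }.

Arguments bundle_proj : clear implicits.

(* The values of [FU] outside [bundle_proj @^-1` U] are irrelevant. *)
Definition local_trivialization (B : vector_fibration) (U : set S)
    (X : hilbertType R) (FU : total_space B -> realified X) : Prop :=
  [/\ open U,
      @smooth_map R (total_space B) (banach_space (realified X)) (bundle_proj B @^-1` U) FU,
      forall s, U s -> linear (fun v : fiber B s => FU (fiber_incl v) : X) &
      @diffeomorphism R (total_space B) (banach_space (S * realified X)%type)
        (bundle_proj B @^-1` U) (U `*` setT) (fun e => (bundle_proj B e, FU e))].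

Record hilbert_bundle := HilbertBundle {
  fibration :> vector_fibration ;
  locally_trivial : forall s : S,
    exists (U : set S) (X : hilbertType R) (FU : total_space fibration -> realified X),
      U s /\ local_trivialization U FU }.

Section bundle.
Variable B : hilbert_bundle.

Definition bsection := forall s : S, fiber B s.

Implicit Types (phi psi : bsection) (xi : vector_field R).

Definition smooth_section phi : Prop :=
  @smooth_map R (banach_space S) (total_space B) setT (fun s => fiber_incl (phi s)).

Definition bs_add phi psi : bsection := fun s => phi s + psi s.

Definition bs_scale (f : S -> C) phi : bsection := fun s => f s *: phi s.

Definition bs_pair (ht : forall s, fiber B s -> fiber B s -> C) phi psi : S -> C :=
  fun s => ht s (phi s) (psi s).

Definition hermitian_metric (ht : forall s, fiber B s -> fiber B s -> C) : Prop :=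
  forall s : S,
    exists (U : set S) (X : hilbertType R) (FU : total_space B -> realified X),
      [/\ U s, local_trivialization U FU &
          forall s', U s' -> forall u v : fiber B s',
            ht s' u v = inner (FU (fiber_incl u) : X) (FU (fiber_incl v) : X)].

Variable nablat : vector_field R -> bsection -> bsection.

(* [A (s, (b, c))] is the value of the connection form on the complex tangent
   vector b d/ds + c d/dsbar at [s]. It takes its values in the closed subspace
   of complex linear operators of [bounded_operator]. *)
Definition connection_form (U : set S) (X : hilbertType R)
    (FU : total_space B -> realified X)
    (A : S * (S * S) -> bounded_operator (realified X) (realified X)) : Prop :=
  [/\ smooth_on (U `*` setT) A,
      forall s v, U s -> linear (A (s, v) : X -> X),
      forall s (a b c b' c' : C) (x : X), U s ->
        A (s, (a * b + b', a * c + c')) x =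
        a *: (A (s, (b, c)) x : X) + A (s, (b', c')) x :> X &
      forall xi phi s, smooth_vf xi -> smooth_section phi -> U s ->
        FU (fiber_incl (nablat xi phi s)) =
        vf_apply_vec xi (fun t => FU (fiber_incl (phi t))) s +
        A (s, (vf_s xi s, vf_sbar xi s)) (FU (fiber_incl (phi s)))].

Record connection : Prop := Connection {
  nablat_smooth : forall xi phi,
    smooth_vf xi -> smooth_section phi -> smooth_section (nablat xi phi) ;
  nablat_linear : forall xi (a : C) phi psi,
    smooth_vf xi -> smooth_section phi -> smooth_section psi ->
    nablat xi (bs_add (bs_scale (fun=> a) phi) psi) =
    bs_add (bs_scale (fun=> a) (nablat xi phi)) (nablat xi psi) ;
  nablat_local : forall (U : set S) (X : hilbertType R)
      (FU : total_space B -> realified X),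
    local_trivialization U FU -> exists A, connection_form U FU A }.

Definition hermitian_connection (ht : forall s, fiber B s -> fiber B s -> C) : Prop :=
  connection /\
  forall xi phi psi s,
    smooth_vf xi -> smooth_section phi -> smooth_section psi ->
    vf_apply xi (bs_pair ht phi psi) s =
    bs_pair ht (nablat xi phi) psi s + bs_pair ht phi (nablat (vf_conj xi) psi) s.

End bundle.

Definition induced_from (H : S -> hilbertType R) (Gamma : set (hsection H))
    (nabla : vector_field R -> hsection H -> hsection H) (B : hilbert_bundle)
    (ht : forall s, fiber B s -> fiber B s -> C)
    (nablat : vector_field R -> bsection B -> bsection B) : Prop :=
  exists F : forall s, H s -> fiber B s,
  [/\ forall s, linear (F s),
      forall s (u : H s), ht s (F s u) (F s u) = inner u u,
      forall phi, Gamma phi -> smooth_section (fun s => F s (phi s)) &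
      forall xi phi, smooth_vf xi -> Gamma phi ->
        nablat xi (fun s => F s (phi s)) = (fun s => F s (nabla xi phi s))].

Definition induced_from_hermitian_bundle (H : S -> hilbertType R)
    (Gamma : set (hsection H))
    (nabla : vector_field R -> hsection H -> hsection H) : Prop :=
  exists (B : hilbert_bundle) (ht : forall s, fiber B s -> fiber B s -> C)
         (nablat : vector_field R -> bsection B -> bsection B),
  [/\ hermitian_metric ht, hermitian_connection nablat ht &
      induced_from Gamma nabla ht nablat].

End hilbert_bundles.

Section example.
Context {R : realType}.
Local Notation C := R[i].
Local Notation S := (Rcomplex R).
Variables (H : S -> hilbertType R) (phi : nat -> hsection H) (k : S -> C).

Definition combination (N : nat) (a : nat -> S -> C) : hsection H :=
  fun s => \sum_(l < N.+1) a l s *: phi l s.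

Definition combinations : set (hsection H) :=
  [set psi | exists N (a : nat -> S -> C),
    (forall l, smooth_fun (a l)) /\ psi = combination N a].

Definition combination_derivative (nabla : vector_field R -> hsection H -> hsection H) :
    Prop :=
  forall eta N (a : nat -> S -> C), smooth_vf eta -> (forall l, smooth_fun (a l)) ->
    nabla eta (combination N a) =
    combination N (fun l s => vf_apply eta (a l) s +
      l.+1%:R * (vf_s eta s * k s - vf_sbar eta s * conjc (k s)) * a l s).

End example.

(* Main.v *)
From HB Require Import structures.
From mathcomp Require Import ring lra landau.
Require Import Defs.
From mathcomp Require Import all_boot all_order all_algebra complex.
From mathcomp Require Import all_classical all_reals topology normedtype derive.

Import Order.TTheory GRing.Theory Num.Theory.
Import numFieldNormedType.Exports.

Set Implicit Arguments.
Unset Strict Implicit.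
Unset Printing Implicit Defensive.

Local Open Scope classical_set_scope.
Local Open Scope ring_scope.
Local Open Scope complex_scope.

(* The sections [phi j] are eigenvectors of the connection, so a word in the
   [nabla (Xi i)] multiplies [phi j] by the iterate of first order scalar operators with
   analytic coefficients applied to the constant 1. Such iterates satisfy Cauchy estimates
   on shrinking squares, hence are bounded by C A^m m!, locally and then on compact sets.

   The curvature of [nabla] acts on [phi j] by the scalar j + 1 times the Laplacian of [g],
   up to a constant. If the field were induced from a hermitian Hilbert bundle, a unitary
   trivialization would turn the [phi j] into unit vectors on which the curvature of the
   bundle, a bounded operator, acts by these scalars; hence the Laplacian would vanish. *)

(** * Calculus in normed spaces *)

(** The contradiction comes from growth in [j]. At a given point the curvature is a single operator
    with a single norm, whereas the unit vectors of index [j] see a scalar proportional to [j + 1].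
    The same factor is harmless for analyticity, which is asked of one section at a time.

    The fibers [H s] share no topology, so a section of [H] has no derivative of its own; it gets
    one in a trivialization, where its first derivatives are given by the connection equations and
    are therefore differentiable again. This is why the symmetry of second derivatives is proved for
    a map differentiable near a point whose first derivatives are differentiable at that point.

    In the estimates, a derivative is not bounded on the square where the function is, so every
    letter of a word gives up some radius. The loss per letter must depend on the length of the
    word, and this is what produces the factorial. *)

Section calculus.
Context {R : realType}.
Implicit Types E F G K : normedModType R.

Lemma is_diff_eps E F (f : E -> F) (df : {linear E -> F}) x : continuous df ->
  (forall e, 0 < e -> \forall h \near 0, `|f (h + x) - f x - df h| <= e * `|h|) ->
  is_diff x f df.
Proof.
move=> dfc fx.
have fo : f \o shift x = cst (f x) + df +o_ 0 id.
  apply/eqaddoP => e e0; near=> h.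
  rewrite [X in `|X|](_ : _ = f (h + x) - f x - df h); last first.
    by rewrite !fctE /= opprD addrA.
  by near: h; exact: fx.
have dfE := diff_unique dfc fo.
by apply: DiffDef => //; apply/diff_locallyP; rewrite dfE.
Unshelve. all: by end_near. Qed.

Lemma continuous_linearP E F (f : E -> F) : linear f ->
  (exists C, forall x, `|f x| <= C * `|x|) -> f \in @continuous_linear R E F.
Proof.
move=> lf [C fC]; apply/asboolP; split=> //.
pose fL : {linear E -> F} := HB.pack f (GRing.isLinear.Build R E F *:%R f lf).
rewrite -[f]/(fL : E -> F); apply/linear_bounded_continuous/linear_boundedP.
exists C; split; first exact: num_real.
by move=> r /ltW Cr x; apply: (le_trans (fC x)); rewrite ler_wpM2r.
Qed.

Lemma bounded_operator_norm_le E F (f : bounded_operator E F) C : 0 <= C ->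
  (forall x, `|f x| <= C * `|x|) -> `|f| <= C.
Proof.
move=> C0 fC; apply: operator_norm_le => x x1; apply: (le_trans (fC x)).
by rewrite -[leRHS]mulr1 ler_wpM2l.
Qed.

Lemma bounded_operatorP E F (f : bounded_operator E F) x : `|f x| <= `|f| * `|x|.
Proof. exact: operator_normP. Qed.

Lemma bounded_operator_eq E F (f g : bounded_operator E F) : f =1 g -> f = g.
Proof. by move=> fg; apply/val_inj/funext. Qed.

(** Multiplication on the plane, scaling of a vector and application of an operator are all
    instances, so that one product rule serves them. *)
Record bounded_bilinear E F G := BoundedBilinear {
  bilin_fun :> E -> F -> G ;
  bilin_linl : forall y, linear (bilin_fun ^~ y) ;
  bilin_linr : forall x, linear (bilin_fun x) ;
  bilin_const : R ;
  bilin_const_ge0 : 0 <= bilin_const ;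
  bilin_le : forall x y, `|bilin_fun x y| <= bilin_const * (`|x| * `|y|) }.

Section bilinear.
Context {E F G : normedModType R} (B : bounded_bilinear E F G).

Lemma bilinDl x x' y : B (x + x') y = B x y + B x' y.
Proof. by have := bilin_linl B y 1 x x'; rewrite !scale1r. Qed.

Lemma bilinDr x y y' : B x (y + y') = B x y + B x y'.
Proof. by have := bilin_linr B x 1 y y'; rewrite !scale1r. Qed.

(* The derivative of [fun x => B (f x) (g x)] is
   [bilin_swap (df x) (g x) + bilin_comp (f x) (dg x)], and both summands are again
   bounded bilinear in the pair they depend on: this drives the induction of [Ck_bilin]. *)
Lemma bilin_swap_subproof (K : normedModType R) (L : bounded_operator K E) y :
  (fun h => B (L h) y) \in @continuous_linear R K G.
Proof.
apply: continuous_linearP => [a u v|]; first by rewrite linearP bilin_linl.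
exists (bilin_const B * `|L| * `|y|) => h; apply: (le_trans (bilin_le B _ _)).
rewrite -!mulrA ler_wpM2l ?bilin_const_ge0// [leRHS]mulrCA mulrC.
by rewrite ler_wpM2l// bounded_operatorP.
Qed.

Definition bilin_swap K (L : bounded_operator K E) y := BoundedOperator (bilin_swap_subproof L y).

Lemma bilin_comp_subproof (K : normedModType R) x (L : bounded_operator K F) :
  (fun h => B x (L h)) \in @continuous_linear R K G.
Proof.
apply: continuous_linearP => [a u v|]; first by rewrite linearP bilin_linr.
exists (bilin_const B * `|x| * `|L|) => h; apply: (le_trans (bilin_le B _ _)).
by rewrite -!mulrA ler_wpM2l ?bilin_const_ge0// ler_wpM2l// bounded_operatorP.
Qed.

Definition bilin_comp K x (L : bounded_operator K F) := BoundedOperator (bilin_comp_subproof x L).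

Lemma bilin_swap_linl K y : linear (@bilin_swap K ^~ y).
Proof.
by move=> a L L'; apply: bounded_operator_eq => h; exact: bilin_linl.
Qed.

Lemma bilin_swap_linr K L : linear (@bilin_swap K L).
Proof.
by move=> a y y'; apply: bounded_operator_eq => h; exact: bilin_linr.
Qed.

Lemma bilin_swap_le K L y : `|@bilin_swap K L y| <= bilin_const B * (`|L| * `|y|).
Proof.
apply: bounded_operator_norm_le => [|h]; first by rewrite !mulr_ge0 ?bilin_const_ge0.
apply: (le_trans (bilin_le B _ _)); rewrite -!mulrA ler_wpM2l ?bilin_const_ge0//.
by rewrite [leRHS]mulrCA mulrC ler_wpM2l// bounded_operatorP.
Qed.

Lemma bilin_comp_linl K L : linear (@bilin_comp K ^~ L).
Proof.
by move=> a y y'; apply: bounded_operator_eq => h; exact: bilin_linl.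
Qed.

Lemma bilin_comp_linr K x : linear (@bilin_comp K x).
Proof.
by move=> a L L'; apply: bounded_operator_eq => h; exact: bilin_linr.
Qed.

Lemma bilin_comp_le K x L : `|@bilin_comp K x L| <= bilin_const B * (`|x| * `|L|).
Proof.
apply: bounded_operator_norm_le => [|h]; first by rewrite !mulr_ge0 ?bilin_const_ge0.
apply: (le_trans (bilin_le B _ _)); rewrite -!mulrA ler_wpM2l ?bilin_const_ge0//.
by rewrite ler_wpM2l// bounded_operatorP.
Qed.

Definition bilinear_swap K := BoundedBilinear (@bilin_swap_linl K) (@bilin_swap_linr K)
  (bilin_const_ge0 B) (@bilin_swap_le K).

Definition bilinear_comp K := BoundedBilinear (@bilin_comp_linl K) (@bilin_comp_linr K)
  (bilin_const_ge0 B) (@bilin_comp_le K).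

Lemma bilin_continuous : continuous (fun p : E * F => B p.1 p.2).
Proof.
move=> -[a b]; rewrite /continuous_at /=; apply/subr_cvg0.
pose C := bilin_const B; have C0 : 0 <= C := bilin_const_ge0 B.
have BE (p : E * F) : B p.1 p.2 - B a b = B (p.1 - a) p.2 + B a (p.2 - b).
  apply/eqP; rewrite subr_eq; apply/eqP.
  by rewrite -addrA -bilinDr subrK -bilinDl subrK.
under eq_fun do rewrite BE.
rewrite -(addr0 (0 : G)); apply: cvgD.
  apply/norm_cvg0P; apply: (@squeeze_cvgr _ _ _ _ (fun=> 0)
    (fun p : E * F => C * (`|p.1 - a| * `|p.2|))) => //.
  - by near=> p; rewrite normr_ge0 /=; exact: bilin_le.
  - exact: cvg_cst.
  - rewrite -(mulr0 C); apply: cvgMl_tmp; rewrite -(mul0r `|b|); apply: cvgM.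
      rewrite -(normr0 E); apply: cvg_norm; apply/subr_cvg0; exact: cvg_fst.
    by apply: cvg_norm; exact: cvg_snd.
apply/norm_cvg0P; apply: (@squeeze_cvgr _ _ _ _ (fun=> 0)
    (fun p : E * F => C * (`|a| * `|p.2 - b|))) => //.
- by near=> p; rewrite normr_ge0 /=; exact: bilin_le.
- exact: cvg_cst.
- rewrite -(mulr0 C); apply: cvgMl_tmp; rewrite -(mulr0 `|a|); apply: cvgMl_tmp.
  by rewrite -(normr0 F); apply: cvg_norm; apply/subr_cvg0; exact: cvg_snd.
Unshelve. all: by end_near. Qed.

Lemma cvg_bilin (T : Type) (U : set_system T) {FU : Filter U} (f : T -> E) (g : T -> F)
    (a : E) (b : F) : f @ U --> a -> g @ U --> b -> B (f x) (g x) @[x --> U] --> B a b.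
Proof.
move=> fa gb; have fgab : (f x, g x) @[x --> U] --> (a, b) by exact: cvg_pair.
have Bab : {for (a, b), continuous (fun p : E * F => B p.1 p.2)} by exact: bilin_continuous.
exact: (continuous_cvg _ Bab fgab).
Qed.

Lemma is_diff_bilin K (f df : K -> E) (g dg : K -> F) x :
  is_diff x f df -> is_diff x g dg ->
  is_diff x (fun t => B (f t) (g t)) (fun h => B (df h) (g x) + B (f x) (dg h)).
Proof.
move=> fx gx.
pose BL : {bilinear E -> F -> G} := HB.pack (B : E -> F -> G)
  (bilinear_isBilinear.Build R E F G *:%R *:%R B (bilin_linl B, bilin_linr B)).
have Bc : continuous (fun p : E * F => BL p.1 p.2) by exact: bilin_continuous.
have Bd : is_diff (f x, g x) (fun p : E * F => BL p.1 p.2)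
    (fun q => BL (f x) q.2 + BL q.1 (g x)).
  by apply: DiffDef; [exact: differentiable_bilin|exact: diff_bilin].
have -> : (fun t => B (f t) (g t)) =
    (fun p : E * F => BL p.1 p.2) \o (fun t => (f t, g t)) by [].
by apply: is_diff_eq; apply/funext => h /=; rewrite addrC.
Qed.

End bilinear.

Lemma CkS n E F (U : set E) (f : E -> F) : Ck n.+1 U f -> Ck n U f.
Proof.
elim: n F f => [|n IHn] F f [df [fdf cdf]].
  by move=> x Ux; apply: differentiable_continuous; have := fdf x Ux => -[].
by exists df; split=> //; exact: IHn.
Qed.

Lemma CkD n E F (U : set E) (f g : E -> F) :
  Ck n U f -> Ck n U g -> Ck n U (fun x => f x + g x).
Proof.
elim: n F f g => [|n IHn] F f g /=.
  by move=> fc gc x Ux; apply: cvgD; [exact: fc|exact: gc].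
move=> [df [fdf cdf]] [dg [gdg cdg]]; exists (fun x => df x + dg x).
split; last exact: IHn.
move=> x Ux; exact: (is_diffD (fdf x Ux) (gdg x Ux)).
Qed.

Lemma Ck_bilin n E F G K (B : bounded_bilinear E F G) (U : set K) f g :
  Ck n U f -> Ck n U g -> Ck n U (fun x => B (f x) (g x)).
Proof.
elim: n E F G B f g => [|n IHn] E F G B f g.
  by move=> fc gc x Ux; apply: cvg_bilin; [exact: fc|exact: gc].
(* The derivative contains [f] and [g] undifferentiated, so the induction hypothesis needs them in
   the lower class as well. *)
move=> cf cg; have := CkS cf; have := CkS cg; move: cf cg.
move=> [df [fdf cdf]] [dg [gdg cdg]] cg cf.
exists (fun x => bilin_swap B (df x) (g x) + bilin_comp B (f x) (dg x)).
split; last by apply: CkD; [exact: (IHn _ _ _ (bilinear_swap B K))|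
                            exact: (IHn _ _ _ (bilinear_comp B K))].
by move=> x Ux; apply: is_diff_bilin; [exact: fdf|exact: gdg].
Qed.

Section operator_application.
Context {E F : normedModType R}.

Lemma op_app_linl (x : E) : linear (fun L : bounded_operator E F => L x).
Proof. by []. Qed.

Lemma op_app_linr (L : bounded_operator E F) : linear L.
Proof. exact: bounded_operator_linear. Qed.

Lemma op_app_le (L : bounded_operator E F) (x : E) : `|L x| <= 1 * (`|L| * `|x|).
Proof. by rewrite mul1r bounded_operatorP. Qed.

Definition op_app := BoundedBilinear op_app_linl op_app_linr ler01 op_app_le.

End operator_application.

Lemma Ck_linear n E F G (U : set G) (L : bounded_operator E F) f :
  Ck n U f -> Ck n U (fun x => L (f x)).
Proof. by move=> cf; apply: (Ck_bilin op_app) => //; exact: Ck_cst. Qed.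

Lemma Ck_derive n E F (U : set E) (f : E -> F) v : Ck n.+1 U f ->
  exists g : E -> F, Ck n U g /\ {in U, 'D_v f =1 g}.
Proof.
move=> [df [fdf cdf]]; exists (fun x => df x v); split.
  by apply: (Ck_bilin op_app) => //; exact: Ck_cst.
by move=> x /set_mem/fdf[d e]; rewrite deriveE// e.
Qed.

Lemma smooth_derive E F (f : E -> F) v : smooth_on setT f -> smooth_on setT ('D_v f).
Proof.
move=> sf n; have [g [cg fg]] := Ck_derive v (sf n.+1).
by rewrite (_ : 'D_v f = g)//; apply/funext => x; apply: fg; rewrite inE.
Qed.

End calculus.
(** * Real-analytic functions on the plane *)

Section monomial_estimates.
Context {R : realFieldType}.
Implicit Types a b r s : R.

(** The left side is one term of the binomial expansion of [(s + (r - s)) ^+ m]. This is Cauchy's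
    estimate for a monomial: one derivative costs one factor [r - s]. *)
Lemma exprM_gap_le m r s : 0 <= s -> s <= r ->
  m%:R * s ^+ m.-1 * (r - s) <= r ^+ m.
Proof.
move=> s0 sr; have r0 := le_trans s0 sr.
elim: m => [|m IHm]; first by rewrite !mul0r expr0 ler01.
rewrite (_ : r ^+ m.+1 = s * r ^+ m + (r - s) * r ^+ m); last by rewrite exprS; ring.
have -> : m.+1%:R * s ^+ m.+1.-1 * (r - s) =
    s * (m%:R * s ^+ m.-1 * (r - s)) + (r - s) * s ^+ m.
  case: m {IHm} => [|m] /=; first by rewrite !mul0r mulr0 expr0; ring.
  by rewrite -[m.+2%:R]natr1 exprS; ring.
apply: lerD; first by rewrite ler_wpM2l.
by rewrite ler_wpM2l ?subr_ge0// lerXn2r ?nnegrE.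
Qed.

(** The factor [m] of the mean value estimate is traded for the gap [r - s], so that the bound is
    uniform in the degree. *)
Lemma exprB_le m a b r s : `|a| <= s -> `|b| <= s -> s <= r ->
  `|a ^+ m - b ^+ m| * (r - s) <= `|a - b| * r ^+ m.
Proof.
move=> sa sb sr; have s0 := le_trans (normr_ge0 a) sa; have r0 := le_trans s0 sr.
elim: m => [|m IHm]; first by rewrite !expr0 subrr normr0 mul0r mulr1.
have -> : a ^+ m.+1 - b ^+ m.+1 = a * (a ^+ m - b ^+ m) + (a - b) * b ^+ m.
  by rewrite !exprS; ring.
rewrite (_ : r ^+ m.+1 = s * r ^+ m + (r - s) * r ^+ m); last by rewrite exprS; ring.
rewrite [leRHS]mulrDr.
apply: (@le_trans _ _ ((`|a| * `|a ^+ m - b ^+ m| + `|a - b| * `|b| ^+ m) * (r - s))).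
  by rewrite ler_wpM2r ?subr_ge0// -normrX -!normrM ler_normD.
rewrite mulrDl; apply: lerD.
  by rewrite -mulrA [leRHS]mulrCA ler_pM ?mulr_ge0 ?subr_ge0.
rewrite -mulrA ler_wpM2l// mulrC ler_wpM2l ?subr_ge0//.
by rewrite lerXn2r ?nnegrE// (le_trans sb).
Qed.

(** The Taylor remainders satisfy [e_(m+1) = a * e_m + (a - b) ^+ 2 * (m%:R * b ^+ m.-1)], and
    [exprM_gap_le] bounds the last factor. *)
Lemma expr_taylor1_le m a b r s : `|a| <= s -> `|b| <= s -> s <= r ->
  `|a ^+ m - b ^+ m - m%:R * (a - b) * b ^+ m.-1| * (r - s) ^+ 2 <=
  `|a - b| ^+ 2 * r ^+ m.
Proof.
move=> sa sb sr; have s0 := le_trans (normr_ge0 a) sa; have r0 := le_trans s0 sr.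
elim: m => [|m IHm].
  by rewrite !expr0 subrr !mul0r subr0 normr0 mul0r mulr1 sqr_ge0.
set e := _ - _ - _ in IHm.
have -> : a ^+ m.+1 - b ^+ m.+1 - m.+1%:R * (a - b) * b ^+ m.+1.-1 =
    a * e + (a - b) ^+ 2 * (m%:R * b ^+ m.-1).
  rewrite /e; case: m {IHm e} => [|m] /=; first by rewrite !expr0 !expr1; ring.
  by rewrite -[m.+2%:R]natr1 !exprS; ring.
rewrite (_ : r ^+ m.+1 = s * r ^+ m + (r - s) * r ^+ m); last by rewrite exprS; ring.
rewrite [leRHS]mulrDr.
apply: (@le_trans _ _ ((`|a| * `|e| + `|a - b| ^+ 2 * (m%:R * `|b| ^+ m.-1)) *
    (r - s) ^+ 2)).
  rewrite ler_wpM2r ?sqr_ge0//; apply: (le_trans (ler_normD _ _)).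
  by rewrite !normrM !normrX normr_nat.
rewrite mulrDl; apply: lerD.
  by rewrite -mulrA [leRHS]mulrCA; apply: ler_pM => //; rewrite mulr_ge0 ?sqr_ge0.
rewrite -mulrA ler_wpM2l ?sqr_ge0// expr2 mulrA mulrC ler_wpM2l ?subr_ge0//.
apply: le_trans (exprM_gap_le m s0 sr); rewrite ler_wpM2r ?subr_ge0//.
by rewrite ler_wpM2l// lerXn2r ?nnegrE.
Qed.

(** The remainder splits into the two one-variable remainders and a cross term. The factor
    [r ^+ (m + n)] matches the weight of the monomial in [pnorm], so these bounds add up over a
    polynomial. *)
Lemma monomial_taylor1_le m n a b c d r s :
  `|a| <= s -> `|b| <= s -> `|c| <= s -> `|d| <= s -> s < r ->
  `|a ^+ m * c ^+ n - b ^+ m * d ^+ n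
    - ((a - b) * (m%:R * (b ^+ m.-1 * d ^+ n)) +
       (c - d) * (n%:R * (b ^+ m * d ^+ n.-1)))| <=
  r ^+ (m + n) *
    ((`|a - b| ^+ 2 + `|c - d| ^+ 2 + `|a - b| * `|c - d|) / (r - s) ^+ 2).
Proof.
move=> sa sb sc sd sr; have s0 := le_trans (normr_ge0 a) sa.
have r0 := le_trans s0 (ltW sr); have rs0 : 0 < r - s by rewrite subr_gt0.
rewrite [leRHS]mulrA ler_pdivlMr ?exprn_gt0//.
pose e := a ^+ m - b ^+ m - m%:R * (a - b) * b ^+ m.-1.
pose e' := c ^+ n - d ^+ n - n%:R * (c - d) * d ^+ n.-1.
rewrite [X in `|X|](_ : _ = e * c ^+ n + b ^+ m * e' +
    (m%:R * b ^+ m.-1) * ((a - b) * (c ^+ n - d ^+ n))); last first.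
  by rewrite /e /e'; ring.
have lecn k x : `|x| <= s -> `|x| ^+ k <= r ^+ k.
  by move=> xs; rewrite lerXn2r ?nnegrE// (le_trans xs)// ltW.
have le_e := expr_taylor1_le m sa sb (ltW sr).
have le_e' := expr_taylor1_le n sc sd (ltW sr).
have le_c := exprB_le n sc sd (ltW sr).
have le_b : m%:R * `|b| ^+ m.-1 * (r - s) <= r ^+ m.
  apply: le_trans (exprM_gap_le m s0 (ltW sr)); rewrite ler_wpM2r ?(ltW rs0)//.
  by rewrite ler_wpM2l// lerXn2r ?nnegrE.
apply: (@le_trans _ _ ((`|e| * (r - s) ^+ 2) * `|c| ^+ n +
    `|b| ^+ m * (`|e'| * (r - s) ^+ 2) +
    (m%:R * `|b| ^+ m.-1 * (r - s)) * (`|a - b| * (`|c ^+ n - d ^+ n| * (r - s))))).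
  rewrite (_ : _ + _ = (`|e| * `|c| ^+ n + `|b| ^+ m * `|e'| +
    m%:R * `|b| ^+ m.-1 * (`|a - b| * `|c ^+ n - d ^+ n|)) * (r - s) ^+ 2); last by ring.
  rewrite ler_wpM2r ?sqr_ge0//; apply: (le_trans (ler_normD _ _)); apply: lerD.
    by apply: (le_trans (ler_normD _ _)); rewrite !normrM !normrX.
  by rewrite !normrM normrX normr_nat.
rewrite (_ : _ * (_ + _ + _) = `|a - b| ^+ 2 * r ^+ m * r ^+ n +
    r ^+ m * (`|c - d| ^+ 2 * r ^+ n) + r ^+ m * (`|a - b| * (`|c - d| * r ^+ n))).
  apply: lerD; first apply: lerD.
  - by apply: ler_pM => //; rewrite ?lecn ?mulr_ge0 ?exprn_ge0 ?(ltW rs0).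
  - by apply: ler_pM => //; rewrite ?lecn ?mulr_ge0 ?exprn_ge0 ?(ltW rs0).
  - apply: ler_pM => //; rewrite ?mulr_ge0 ?exprn_ge0 ?(ltW rs0)//.
    by rewrite ler_wpM2l.
by rewrite exprD; ring.
Qed.

End monomial_estimates.

(** * Smooth functions on the plane and their directional derivatives *)

Section plane_calculus.
Context {R : realType}.
Local Notation S := (Rcomplex R).
Implicit Types (x y z : S) (f g : S -> S).

Lemma normM x y : `|x * y : S| = `|x| * `|y|.
Proof. exact: Normc.normcM. Qed.

Lemma norm_1 : `|1 : S| = 1 :> R.
Proof. by rewrite /Num.norm /= expr1n expr0n addr0 sqrtr1. Qed.

Lemma norm_i : `|('i%C : S)| = 1 :> R.
Proof. by rewrite /Num.norm /= expr0n expr1n add0r sqrtr1. Qed.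

Lemma norm_conj x : `|conjc x : S| = `|x|.
Proof. by case: x => a b; rewrite /Num.norm /= sqrrN. Qed.

Lemma mulS_le x y : `|x * y : S| <= 1 * (`|x| * `|y|).
Proof. by rewrite normM mul1r. Qed.

Lemma mulS_linl y : linear (fun x => x * y : S).
Proof. by move=> a x x'; rewrite mulrDl scalerAl. Qed.

Lemma scaleSr (a : R) x y : x * (a *: y) = a *: (x * y) :> S.
Proof. by rewrite mulrC -scalerAl mulrC. Qed.

Lemma mulS_linr x : linear (fun y => x * y : S).
Proof. by move=> a y y'; rewrite mulrDr scaleSr. Qed.

Definition mulS := BoundedBilinear mulS_linl mulS_linr ler01 mulS_le.

Lemma conj_linear : linear (fun x => conjc x : S).
Proof. by move=> a x y; rewrite rmorphD; congr (_ + _); exact: conjc_is_scalable. Qed.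

Lemma conj_op_subproof : (fun x => conjc x : S) \in @continuous_linear R S S.
Proof.
apply: continuous_linearP; first exact: conj_linear.
by exists 1 => x; rewrite norm_conj mul1r.
Qed.

Definition conj_op := BoundedOperator conj_op_subproof.

Lemma Re_op_subproof : (@complex.Re R : S -> R) \in @continuous_linear R S R.
Proof.
apply: continuous_linearP; first exact: linearP.
by exists 1 => x; rewrite mul1r Re_le_norm.
Qed.

Definition Re_op := BoundedOperator Re_op_subproof.

Lemma Im_op_subproof : (@complex.Im R : S -> R) \in @continuous_linear R S R.
Proof.
apply: continuous_linearP; first exact: linearP.
by exists 1 => x; rewrite mul1r Im_le_norm.
Qed.

Definition Im_op := BoundedOperator Im_op_subproof.

Section scaling.
Context {V : normedModType R}.

Lemma scale_linl (v : V) : linear (fun a : R => a *: v).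
Proof. by move=> c a b; rewrite scalerDl scalerA. Qed.

Lemma scale_linr (a : R) : linear (fun v : V => a *: v).
Proof. by move=> c v w; rewrite scalerDr !scalerA mulrC. Qed.

Lemma scale_le (a : R) (v : V) : `|a *: v| <= 1 * (`|a| * `|v|).
Proof. by rewrite normrZ mul1r. Qed.

Definition scale_bilin := BoundedBilinear scale_linl scale_linr ler01 scale_le.

End scaling.

Lemma Re_Im_decomp z : z = complex.Re z *: (1 : S) + complex.Im z *: ('i%C : S).
Proof.
case: z => a b /=; rewrite -[1 : S]/(1 +i* 0)%C.
by rewrite /GRing.scale /= !mulr0 !mulr1; congr (_ +i* _)%C; rewrite ?addr0 ?add0r.
Qed.

Lemma diff_Re_Im (V : normedModType R) (f : S -> V) z h : differentiable f z ->
  'd f z h = complex.Re h *: 'D_(1 : S) f z + complex.Im h *: 'D_('i%C : S) f z.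
Proof.
by move=> df; rewrite !deriveE// {1}(Re_Im_decomp h) linearD !linearZ.
Qed.

Lemma smooth_diff (E F : normedModType R) (f : E -> F) (x : E) :
  @smooth_on R E F setT f -> differentiable f x.
Proof. by move=> /(_ 1%N)[df [/(_ x I)[]]]. Qed.

Lemma smooth_fun_cst (a : S) : smooth_fun (fun=> a).
Proof. by move=> n; exact: Ck_cst. Qed.

Lemma smooth_funD f g : smooth_fun f -> smooth_fun g -> smooth_fun (fun s => f s + g s).
Proof. by move=> sf sg n; apply: CkD; [exact: sf|exact: sg]. Qed.

Lemma smooth_funM f g : smooth_fun f -> smooth_fun g -> smooth_fun (fun s => f s * g s).
Proof. by move=> sf sg n; apply: (Ck_bilin mulS); [exact: sf|exact: sg]. Qed.

Lemma smooth_fun_conj f : smooth_fun f -> smooth_fun (fun s => conjc (f s)).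
Proof. by move=> sf n; apply: (Ck_linear conj_op); exact: sf. Qed.

Lemma smooth_funZ (a : R) f : smooth_fun f -> smooth_fun (fun s => a *: f s : S).
Proof.
move=> sf n; apply: (Ck_bilin (@scale_bilin S)); last exact: sf.
exact: Ck_cst.
Qed.

Lemma smooth_funN f : smooth_fun f -> smooth_fun (fun s => - f s).
Proof.
move=> sf; have := smooth_funZ (-1) sf.
by under eq_fun do rewrite scaleN1r.
Qed.

Lemma smooth_fun_sum n (f : nat -> S -> S) : (forall i, smooth_fun (f i)) ->
  smooth_fun (fun s => \sum_(i < n) f i s).
Proof.
move=> sf; elim: n => [|n IHn].
  by under eq_fun do rewrite big_ord0; exact: smooth_fun_cst.
by under eq_fun do rewrite big_ord_recr; exact: smooth_funD.
Qed.

Lemma smooth_d_ds f : smooth_fun f -> smooth_fun (d_ds f).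
Proof.
move=> sf; apply: smooth_funZ; apply: smooth_funD; first exact: smooth_derive.
apply/smooth_funN/smooth_funM; first exact: smooth_fun_cst.
exact: smooth_derive.
Qed.

Lemma smooth_d_dsbar f : smooth_fun f -> smooth_fun (d_dsbar f).
Proof.
move=> sf; apply: smooth_funZ; apply: smooth_funD; first exact: smooth_derive.
apply/smooth_funM; first exact: smooth_fun_cst.
exact: smooth_derive.
Qed.

Lemma smooth_vf_apply xi f : smooth_vf xi -> smooth_fun f -> smooth_fun (vf_apply xi f).
Proof.
move=> [s1 s2] sf; apply: smooth_funD; apply: smooth_funM => //.
  exact: smooth_d_ds.
exact: smooth_d_dsbar.
Qed.

Lemma derive_bilin (E F G : normedModType R) (B : bounded_bilinear E F G) (K : normedModType R)
    (f : K -> E) (g : K -> F) (x v : K) :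
  differentiable f x -> differentiable g x ->
  'D_v (fun t => B (f t) (g t)) x = B ('D_v f x) (g x) + B (f x) ('D_v g x).
Proof.
move=> df dg; have := is_diff_bilin B (differentiableP df) (differentiableP dg).
by case=> dB eB; rewrite !deriveE// eB.
Qed.

Lemma differentiable_bounded_bilin (E F G : normedModType R) (B : bounded_bilinear E F G)
    (K : normedModType R) (f : K -> E) (g : K -> F) (x : K) :
  differentiable f x -> differentiable g x -> differentiable (fun t => B (f t) (g t)) x.
Proof. by move=> /differentiableP df /differentiableP dg; case: (is_diff_bilin B df dg). Qed.

Lemma is_diff_op (E F K : normedModType R) (L : bounded_operator E F)
    (f : K -> E) (x : K) : differentiable f x ->
  is_diff x (fun t => L (f t)) (fun h => L ('d f x h)).
Proof.
move=> df; have := is_diff_bilin op_app (is_diff_cst L x) (differentiableP df).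
by move/is_diff_eq; apply; apply/funext => h; rewrite /= add0r.
Qed.

Lemma derive_op (E F K : normedModType R) (L : bounded_operator E F)
    (f : K -> E) (x v : K) : differentiable f x -> 'D_v (fun t => L (f t)) x = L ('D_v f x).
Proof. by move=> df; have [dL eL] := is_diff_op L df; rewrite !deriveE// eL. Qed.

End plane_calculus.

(** * Limits of polynomials with bounded weighted norms *)

Section polynomial_limits.
Context {R : realType}.
Local Notation S := (Rcomplex R).
Implicit Types (f g : S -> S) (p z : S) (r M : R).

(** A coefficient with its two exponents. Polynomials are lists of these with repetitions allowed,
    so that sums are concatenations and products are lists of all pairs, with no terms to
    collect. *)
Definition monomial := (S * (nat * nat))%type.
Implicit Types (t : monomial) (l : seq monomial).

Definition mono_eval t z : S := (complex.Re z ^+ t.2.1 * complex.Im z ^+ t.2.2) *: t.1.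
Definition mono_norm t r : R := `|t.1| * r ^+ (t.2.1 + t.2.2).
Definition peval l z : S := \sum_(t <- l) mono_eval t z.
Definition pnorm l r : R := \sum_(t <- l) mono_norm t r.

(** At exponent 0 the truncated predecessor is harmless, since the coefficient vanishes. *)
Definition mono_dx t : monomial := (t.2.1%:R *: t.1, (t.2.1.-1, t.2.2)).
Definition mono_dy t : monomial := (t.2.2%:R *: t.1, (t.2.1, t.2.2.-1)).

Definition square_nbhs r : set S :=
  [set z | `|complex.Re z| < r /\ `|complex.Im z| < r].

(* [f], expanded at [p], is on the square of radius [r] a pointwise limit of
   polynomials whose weighted l1 norms at radius [r] are at most [M]. Unlike power
   series, this class is visibly closed under products. *)
Definition polylim p r M f : Prop := exists l : nat -> seq monomial,
  (forall N, pnorm (l N) r <= M) /\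
  forall z, square_nbhs r z -> peval (l N) z @[N --> \oo] --> (f (p + z) : S).

Lemma mono_norm_ge0 t r : 0 <= r -> 0 <= mono_norm t r.
Proof. by move=> r0; rewrite mulr_ge0 ?exprn_ge0. Qed.

Lemma pnorm_ge0 l r : 0 <= r -> 0 <= pnorm l r.
Proof. by move=> r0; apply: sumr_ge0 => t _; exact: mono_norm_ge0. Qed.

Lemma pnorm_le l r r' : 0 <= r' -> r' <= r -> pnorm l r' <= pnorm l r.
Proof.
move=> r0 rr; apply: ler_sum => t _; rewrite ler_wpM2l//.
by rewrite lerXn2r ?nnegrE// (le_trans r0).
Qed.

Lemma peval_le l r z : square_nbhs r z -> `|peval l z| <= pnorm l r.
Proof.
move=> [zx zy]; apply: (le_trans (ler_norm_sum _ _ _)); apply: ler_sum => t _.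
rewrite normrZ mulrC ler_wpM2l// normrM !normrX exprD.
have r0 := le_lt_trans (normr_ge0 _) zx.
by rewrite ler_pM ?exprn_ge0// lerXn2r ?nnegrE// ltW.
Qed.

(** The polynomial enters the constant only through [pnorm l r], so the bound survives a limit of
    polynomials. The 3 counts the three quadratic terms of [monomial_taylor1_le], each at most the
    squared norm of [z' - z]. *)
Lemma peval_taylor1_le l r s z z' : s < r -> square_nbhs s z -> square_nbhs s z' ->
  `|peval l z' - peval l z -
    (complex.Re (z' - z) *: peval [seq mono_dx t | t <- l] z +
     complex.Im (z' - z) *: peval [seq mono_dy t | t <- l] z)| <=
  pnorm l r * (3 / (r - s) ^+ 2) * `|z' - z| ^+ 2.
Proof.
move=> sr [zx zy] [zx' zy'].
rewrite /peval !big_map !scaler_sumr -sumrB -big_split -sumrB /=.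
apply: (le_trans (ler_norm_sum _ _ _)); rewrite /pnorm !mulr_suml.
apply: ler_sum => -[c [m n]] _; rewrite /mono_eval /mono_norm /=.
set a := complex.Re z'; set b := complex.Re z.
set a' := complex.Im z'; set b' := complex.Im z.
rewrite [X in `|X|](_ : _ = (a ^+ m * a' ^+ n - b ^+ m * b' ^+ n -
    ((a - b) * (m%:R * (b ^+ m.-1 * b' ^+ n)) +
     (a' - b') * (n%:R * (b ^+ m * b' ^+ n.-1)))) *: c); last first.
  rewrite !scalerBl scalerDl !scalerA !raddfB /=.
  by congr (_ - (_ *: _ + _ *: _)); ring.
rewrite normrZ mulrC -!mulrA ler_wpM2l//.
apply: (le_trans (monomial_taylor1_le m n (ltW zx') (ltW zx) (ltW zy') (ltW zy) sr)).
rewrite ler_wpM2l ?exprn_ge0 ?(le_trans _ (ltW sr)) ?(le_trans _ (ltW zx))//.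
rewrite [leRHS]mulrCA [leLHS]mulrC ler_wpM2l ?invr_ge0 ?sqr_ge0//.
have ax : `|a - b| <= `|z' - z| by rewrite -raddfB Re_le_norm.
have ay : `|a' - b'| <= `|z' - z| by rewrite -raddfB Im_le_norm.
have -> : 3 * `|z' - z| ^+ 2 = `|z' - z| ^+ 2 + `|z' - z| ^+ 2 + `|z' - z| * `|z' - z|.
  by ring.
by rewrite !lerD ?lerXn2r ?nnegrE ?ler_pM.
Qed.

Lemma pnorm_dx_le l r s : 0 <= s -> s < r ->
  pnorm [seq mono_dx t | t <- l] s <= pnorm l r / (r - s).
Proof.
move=> s0 sr; rewrite ler_pdivlMr ?subr_gt0// /pnorm big_map mulr_suml.
apply: ler_sum => -[c [m n]] _; rewrite /mono_norm /= normrZ normr_nat !exprD.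
rewrite [leLHS](_ : _ = `|c| * ((m%:R * s ^+ m.-1 * (r - s)) * s ^+ n)); last by ring.
rewrite ler_wpM2l//; have r0 := le_trans s0 (ltW sr).
apply: ler_pM; rewrite ?exprn_ge0//.
- by rewrite !mulr_ge0 ?exprn_ge0// subr_ge0 ltW.
- exact: exprM_gap_le (ltW _).
- by rewrite lerXn2r ?nnegrE// ltW.
Qed.

Lemma pnorm_dy_le l r s : 0 <= s -> s < r ->
  pnorm [seq mono_dy t | t <- l] s <= pnorm l r / (r - s).
Proof.
move=> s0 sr; rewrite ler_pdivlMr ?subr_gt0// /pnorm big_map mulr_suml.
apply: ler_sum => -[c [m n]] _; rewrite /mono_norm /= normrZ normr_nat !exprD.
rewrite [leLHS](_ : _ = `|c| * (s ^+ m * (n%:R * s ^+ n.-1 * (r - s)))); last by ring.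
rewrite ler_wpM2l//; have r0 := le_trans s0 (ltW sr).
apply: ler_pM; rewrite ?exprn_ge0//.
- by rewrite !mulr_ge0 ?exprn_ge0// subr_ge0 ltW.
- by rewrite lerXn2r ?nnegrE// ltW.
- exact: exprM_gap_le (ltW _).
Qed.

Lemma cvg_norm_le (V : normedModType R) (u : nat -> V) (l : V) M :
  u @ \oo --> l -> (forall N, `|u N| <= M) -> `|l| <= M.
Proof.
move=> ul uM; have nl : `|u N| @[N --> \oo] --> `|l| by exact: cvg_norm.
rewrite -(cvg_lim _ nl)//; apply: limr_le; first by apply/cvg_ex; exists `|l|.
by near=> N; exact: uM.
Unshelve. all: by end_near. Qed.

Lemma polylim_le p r M f z : polylim p r M f -> square_nbhs r z -> `|f (p + z)| <= M.
Proof.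
move=> [l [lM lf]] rz; apply: (cvg_norm_le (lf z rz)) => N.
exact: le_trans (peval_le _ rz) (lM N).
Qed.

Lemma polylim_ge0 p r M f : 0 <= r -> polylim p r M f -> 0 <= M.
Proof. by move=> r0 [l [lM _]]; apply: le_trans (lM 0%N); exact: pnorm_ge0. Qed.

Lemma polylimW p r M r' M' f : 0 <= r' -> r' <= r -> M <= M' ->
  polylim p r M f -> polylim p r' M' f.
Proof.
move=> r0 rr MM [l [lM lf]]; exists l; split=> [N|z [zx zy]].
  by rewrite (le_trans (pnorm_le _ _ rr))// (le_trans (lM N)).
by apply: lf; split; [exact: lt_le_trans zx rr|exact: lt_le_trans zy rr].
Qed.

Lemma polylim_eq p r M f g : f =1 g -> polylim p r M f -> polylim p r M g.
Proof. by move=> /funext ->. Qed.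

Lemma polylim_cst p r (c : S) : polylim p r `|c| (fun=> c).
Proof.
exists (fun=> [:: (c, (0, 0)%N)]); split=> [N|z _].
  by rewrite /pnorm big_seq1 /mono_norm /= expr0 mulr1.
rewrite /peval; under eq_fun do rewrite big_seq1 /mono_eval /= !expr0 mulr1 scale1r.
exact: cvg_cst.
Qed.

Lemma polylimD p r M M' f g : polylim p r M f -> polylim p r M' g ->
  polylim p r (M + M') (fun s => f s + g s).
Proof.
move=> [l [lM lf]] [l' [lM' lg]]; exists (fun N => l N ++ l' N); split=> [N|z rz].
  by rewrite /pnorm big_cat /= lerD//; [exact: lM|exact: lM'].
rewrite /peval; under eq_fun do rewrite big_cat /=.
by apply: cvgD; [exact: lf|exact: lg].
Qed.

Lemma polylimM p r M M' f g : 0 <= r -> polylim p r M f -> polylim p r M' g ->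
  polylim p r (M * M') (fun s => f s * g s).
Proof.
move=> r0 [l [lM lf]] [l' [lM' lg]].
pose mul (t t' : monomial) : monomial :=
  (t.1 * t'.1, (t.2.1 + t'.2.1, t.2.2 + t'.2.2)%N).
exists (fun N => [seq mul t t' | t <- l N, t' <- l' N]); split=> [N|z rz].
  rewrite /pnorm big_allpairs_dep /=.
  under eq_bigr do under eq_bigr do
    rewrite /mono_norm /= normM addnACA exprD mulrACA.
  under eq_bigr do rewrite -mulr_sumr.
  by rewrite -mulr_suml ler_pM ?pnorm_ge0//; [exact: lM|exact: lM'].
have -> : (fun N => peval [seq mul t t' | t <- l N, t' <- l' N] z) =
    (fun N => peval (l N) z * peval (l' N) z).
  apply/funext => N; rewrite /peval big_allpairs_dep /= mulr_suml.
  apply: eq_bigr => t _; rewrite mulr_sumr; apply: eq_bigr => t' _.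
  rewrite /mono_eval /= scaleSr -scalerAl scalerA; congr (_ *: _).
  by rewrite !exprD; ring.
by apply: (cvg_bilin (B := mulS)); [exact: lf|exact: lg].
Qed.

Lemma polylim_conj p r M f : polylim p r M f -> polylim p r M (fun s => conjc (f s)).
Proof.
move=> [l [lM lf]]; exists (fun N => [seq (conjc t.1, t.2) : monomial | t <- l N]).
split=> [N|z rz].
  rewrite /pnorm big_map; apply: le_trans (lM N); apply: ler_sum => t _.
  by rewrite /mono_norm norm_conj.
have -> : (fun N => peval [seq (conjc t.1, t.2) : monomial | t <- l N] z) =
    (fun N => conj_op (peval (l N) z)).
  apply/funext => N; rewrite /peval big_map linear_sum; apply: eq_bigr => t _.
  by rewrite /mono_eval linearZ.
by apply: continuous_cvg; [exact: bounded_operator_continuous|exact: lf].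
Qed.

Lemma square_nbhs_open r z : square_nbhs r z -> \forall h \near 0, square_nbhs r (h + z).
Proof.
move=> [zx zy]; pose e := Num.min (r - `|complex.Re z|) (r - `|complex.Im z|).
have e0 : 0 < e by rewrite lt_min !subr_gt0 zx.
near=> h; have he : `|h| < e by near: h; apply: nbhs0_lt.
move: he; rewrite lt_min => /andP[hx hy]; split; rewrite raddfD.
  rewrite (le_lt_trans (ler_normD _ _))// -ltrBrDr.
  exact: le_lt_trans (Re_le_norm _) _.
rewrite (le_lt_trans (ler_normD _ _))// -ltrBrDr.
exact: le_lt_trans (Im_le_norm _) _.
Unshelve. all: by end_near. Qed.

End polynomial_limits.

(** * Differentiation of these limits and smoothness of analytic functions *)

Section differentiation_of_limits.
Context {R : realType}.
Local Notation S := (Rcomplex R).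
Implicit Types (f g : S -> S) (p z : S) (r s M : R) (l : nat -> seq (@monomial R)).

(* The Taylor bound being uniform in [N], the derivatives of the approximants are
   within [O(|h|)] of the difference quotients of [f], hence form a Cauchy sequence. *)
Lemma cvg_approximants l s (f' : S -> S) (d : seq (@monomial R) -> seq (@monomial R))
    (v : S) C z :
  `|v| = 1 -> 0 <= C -> square_nbhs s z ->
  (forall z, square_nbhs s z -> peval (l N) z @[N --> \oo] --> f' z) ->
  (forall (t : R) N, square_nbhs s (t *: v + z) ->
    `|peval (l N) (t *: v + z) - peval (l N) z - t *: peval (d (l N)) z| <= C * t ^+ 2) ->
  cvg (peval (d (l N)) z @[N --> \oo]).
Proof.
move=> v1 C0 sz lf' taylor; apply: cauchy_cvg; apply: cauchy_exP => e e0.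
have : \forall t \near 0^'+, square_nbhs s (t *: v + z).
  have /nbhs_norm0P[d0 d00 sd0] := square_nbhs_open sz.
  near=> t; apply: sd0 => /=; rewrite normrZ v1 mulr1.
  rewrite gtr0_norm; last by near: t; exact: nbhs_right_gt.
  by near: t; exact: (nbhs_right_lt d00).
move=> near_t; have C1 : 0 < C + 1 by rewrite ltr_wpDl.
near (0 : R)^'+ => t.
have t0 : 0 < t by [].
have st : square_nbhs s (t *: v + z) by near: t.
have Ct : C * t < e / 2.
  rewrite (@le_lt_trans _ _ ((C + 1) * t))// ?ler_pM2r ?lerDl//.
  rewrite mulrC -ltr_pdivlMr//; near: t; apply: nbhs_right_lt.
  by rewrite !divr_gt0.
(* The centre of the ball is the difference quotient of the limit. Half of [e] pays for the Taylor
   remainder, the other half for the convergence at the two end points. *)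
exists (t^-1 *: (f' (t *: v + z) - f' z)).
have /cvgrPdist_lt/(_ (t * (e / 2))) q : peval (l N) (t *: v + z) - peval (l N) z
    @[N --> \oo] --> f' (t *: v + z) - f' z by apply: cvgB; exact: lf'.
rewrite /=; near=> N; rewrite -ball_normE /=.
have -> : t^-1 *: (f' (t *: v + z) - f' z) - peval (d (l N)) z =
    t^-1 *: ((f' (t *: v + z) - f' z - (peval (l N) (t *: v + z) - peval (l N) z)) +
      (peval (l N) (t *: v + z) - peval (l N) z - t *: peval (d (l N)) z)).
  rewrite addrA subrK [in RHS]scalerBr scalerA mulVf ?scale1r// gt_eqF//.
rewrite normrZ normfV gtr0_norm// ltr_pdivrMl//.
rewrite [e]splitr mulrDr; apply: (le_lt_trans (ler_normD _ _)); apply: ltr_leD.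
  by near: N; apply: q; rewrite mulr_gt0 ?divr_gt0.
apply: (le_trans (taylor t N st)).
by rewrite expr2 mulrCA ler_pM2l// ltW.
Unshelve. all: by end_near. Qed.

(** The Taylor estimate of the approximants is uniform in [N] and passes to the limit, so the limits
    of their partial derivatives are the partial derivatives of [f]. The new constant is Cauchy's
    estimate. *)
Lemma polylim_differentiable p r s M f : 0 < s -> s < r -> polylim p r M f ->
  [/\ forall z, square_nbhs s z -> differentiable f (p + z),
      polylim p s (M / (r - s)) ('D_(1 : S) f) &
      polylim p s (M / (r - s)) ('D_('i%C : S) f)].
Proof.
move=> s0 sr [l [lM lf]].
have lfs z : square_nbhs s z -> peval (l N) z @[N --> \oo] --> (f (p + z) : S).
  by move=> [zx zy]; apply: lf; split; exact: lt_trans sr.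
pose C := M * (3 / (r - s) ^+ 2).
have M0 : 0 <= M by apply: le_trans (lM 0%N); rewrite pnorm_ge0// (le_trans (ltW s0))// ltW.
have C0 : 0 <= C by rewrite mulr_ge0// divr_ge0 ?sqr_ge0.
have taylor N z z' : square_nbhs s z -> square_nbhs s z' ->
    `|peval (l N) z' - peval (l N) z -
    (complex.Re (z' - z) *: peval [seq mono_dx t | t <- l N] z +
     complex.Im (z' - z) *: peval [seq mono_dy t | t <- l N] z)| <=
    C * `|z' - z| ^+ 2.
  move=> sz sz'; apply: (le_trans (peval_taylor1_le (l N) sr sz sz')).
  by rewrite ler_wpM2r ?sqr_ge0// ler_wpM2r ?lM// divr_ge0 ?sqr_ge0.
have dxc z : square_nbhs s z -> cvg (peval [seq mono_dx t | t <- l N] z @[N --> \oo]).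
  move=> sz; apply: (@cvg_approximants l s (fun z => f (p + z)) (map (@mono_dx R)) 1 C z
    _ C0 sz lfs).
    exact: norm_1.
  move=> t N st; have := taylor N z _ sz st; rewrite addrK.
  rewrite (_ : complex.Re _ = t); last by rewrite /= mulr1.
  rewrite (_ : complex.Im _ = 0); last by rewrite /= mulr0.
  rewrite scale0r addr0 normrZ norm_1 mulr1.
  by rewrite real_normK ?num_real.
have dyc z : square_nbhs s z -> cvg (peval [seq mono_dy t | t <- l N] z @[N --> \oo]).
  move=> sz; apply: (@cvg_approximants l s (fun z => f (p + z)) (map (@mono_dy R)) 'i%C C z
    _ C0 sz lfs).
    exact: norm_i.
  move=> t N st; have := taylor N z _ sz st; rewrite addrK.
  rewrite (_ : complex.Re _ = 0); last by rewrite /= mulr0.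
  rewrite (_ : complex.Im _ = t); last by rewrite /= mulr1.
  rewrite scale0r add0r normrZ norm_i mulr1.
  by rewrite real_normK ?num_real.
pose fx z := lim (peval [seq mono_dx t | t <- l N] z @[N --> \oo]).
pose fy z := lim (peval [seq mono_dy t | t <- l N] z @[N --> \oo]).
have ftaylor z z' : square_nbhs s z -> square_nbhs s z' ->
    `|f (p + z') - f (p + z) -
    (complex.Re (z' - z) *: fx z + complex.Im (z' - z) *: fy z)| <=
    C * `|z' - z| ^+ 2.
  move=> sz sz'; apply: cvg_norm_le (fun N => taylor N z z' sz sz').
  apply: cvgB; first by apply: cvgB; exact: lfs.
  by apply: cvgD; apply: cvgZl_tmp; [exact: dxc|exact: dyc].
(* [bilin_swap scale_bilin Re_op v] is the operator sending [h] to [complex.Re h *: v]; likewise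
   with [Im_op]. *)
have fdiff z : square_nbhs s z -> is_diff (p + z) f
    (bilin_swap scale_bilin Re_op (fx z) + bilin_swap scale_bilin Im_op (fy z)).
  move=> sz; apply: is_diff_eps => [|e e0]; first exact: bounded_operator_continuous.
  near=> h; rewrite -[X in _ - X]/(complex.Re h *: fx z + complex.Im h *: fy z).
  have shz : square_nbhs s (h + z) by near: h; exact: square_nbhs_open.
  have := ftaylor _ _ sz shz; rewrite addrK (addrCA h p z).
  move=> /le_trans; apply; rewrite expr2 mulrA ler_wpM2r//.
  have h1 : `|h| <= e / (C + 1).
    by near: h; apply: nbhs0_le; rewrite divr_gt0// ltr_wpDl.
  rewrite (@le_trans _ _ ((C + 1) * `|h|))//; first by rewrite ler_wpM2r// lerDl.
  by rewrite mulrC -ler_pdivlMr ?ltr_wpDl.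
have fDx z : square_nbhs s z -> 'D_(1 : S) f (p + z) = fx z.
  move=> /fdiff[d e]; rewrite deriveE// e -[LHS]/(complex.Re _ *: fx z + complex.Im _ *: fy z) /=.
  by rewrite scale1r scale0r addr0.
have fDy z : square_nbhs s z -> 'D_('i%C : S) f (p + z) = fy z.
  move=> /fdiff[d e]; rewrite deriveE// e -[LHS]/(complex.Re _ *: fx z + complex.Im _ *: fy z) /=.
  by rewrite scale1r scale0r add0r.
split; first by move=> z /fdiff[].
  exists (fun N => [seq mono_dx t | t <- l N]); split=> [N|z sz].
    apply: (le_trans (pnorm_dx_le _ (ltW s0) sr)).
    by rewrite ler_wpM2r ?invr_ge0 ?subr_ge0 ?(ltW sr)// lM.
  by rewrite fDx//; exact: dxc.
exists (fun N => [seq mono_dy t | t <- l N]); split=> [N|z sz].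
  apply: (le_trans (pnorm_dy_le _ (ltW s0) sr)).
  by rewrite ler_wpM2r ?invr_ge0 ?subr_ge0 ?(ltW sr)// lM.
by rewrite fDy//; exact: dyc.
Unshelve. all: by end_near. Qed.

Definition locally_polylim f := forall p, exists r M, 0 < r /\ polylim p r M f.

Lemma locally_polylim_derive f : locally_polylim f ->
  [/\ forall p, differentiable f p, locally_polylim ('D_(1 : S) f) &
      locally_polylim ('D_('i%C : S) f)].
Proof.
have half p r M : 0 < r -> polylim p r M f -> [/\ 0 < r / 2,
    forall z, square_nbhs (r / 2) z -> differentiable f (p + z),
      polylim p (r / 2) (M / (r - r / 2)) ('D_(1 : S) f) &
      polylim p (r / 2) (M / (r - r / 2)) ('D_('i%C : S) f)].
  move=> r0 pf; have r20 : 0 < r / 2 by rewrite divr_gt0.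
  have r2r : r / 2 < r by rewrite ltr_pdivrMr// ltr_pMr// ltr1n.
  by have [? ? ?] := polylim_differentiable r20 r2r pf.
move=> pf; split=> p; have [r [M [r0 prf]]] := pf p; have [r20 d dx dy] := half _ _ _ r0 prf.
- by rewrite -[p]addr0; apply: d; split; rewrite raddf0 normr0.
- by exists (r / 2), (M / (r - r / 2)).
- by exists (r / 2), (M / (r - r / 2)).
Qed.

Lemma locally_polylim_smooth f : locally_polylim f -> smooth_fun f.
Proof.
move=> pf n; elim: n f pf => [|n IHn] f pf; have [d dx dy] := locally_polylim_derive pf.
  by move=> p _; apply: differentiable_continuous; exact: d.
pose I1 : bounded_operator S S := BoundedOperator (id_bounded S).
exists (fun p => bilin_swap scale_bilin Re_op ('D_(1 : S) f p) +
                 bilin_swap scale_bilin Im_op ('D_('i%C : S) f p)).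
split.
  move=> p _; apply: DiffDef; first exact: d.
  by apply/funext => h; rewrite diff_Re_Im.
by apply: CkD; apply: (Ck_bilin (bilinear_swap scale_bilin S));
   [exact: Ck_cst|exact: IHn|exact: Ck_cst|exact: IHn].
Qed.

(** The square partial sums of the power series are the approximants; absolute convergence at [r]
    bounds their norms. *)
Lemma analytic_at_polylim f p : analytic_at f p -> exists r M, 0 < r /\ polylim p r M f.
Proof.
move=> [c [r [r0 [M cM] cf]]]; exists r, M; split=> //.
exists (fun N => [seq (c m n, (m, n)) : monomial | m <- iota 0 N, n <- iota 0 N]).
have sum1 (V : nmodType) (F : nat -> V) N : \sum_(m <- iota 0 N) F m = \sum_(m < N) F m.
  by rewrite -(big_mkord xpredT F) /index_iota subn0.
have sumE (V : nmodType) (F : nat -> nat -> V) N :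
    \sum_(m <- iota 0 N) \sum_(n <- iota 0 N) F m n = \sum_(m < N) \sum_(n < N) F m n.
  by rewrite sum1; apply: eq_bigr => m _; rewrite sum1.
split=> [N|z [zx zy]]; first by rewrite /pnorm big_allpairs_dep sumE; exact: cM.
have := cf _ _ zx zy; rewrite (_ : _ +i* _ = z)%C; last by case: (z).
apply: cvg_trans; apply: near_eq_cvg; near=> N.
by rewrite /peval big_allpairs_dep sumE.
Unshelve. all: by end_near.
Qed.

Lemma analytic_smooth f : (forall p, analytic_at f p) -> smooth_fun f.
Proof. by move=> af; apply: locally_polylim_smooth => p; exact: analytic_at_polylim. Qed.

End differentiation_of_limits.
(** * Iterates of first order operators *)

Section cauchy_estimates.
Context {R : realType}.
Local Notation S := (Rcomplex R).
Implicit Types (f g u : S -> S) (p z : S) (r M K B : R) (xi : vector_field R).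

Lemma polylimZ p r M (a : R) f : 0 <= r -> polylim p r M f ->
  polylim p r (`|a| * M) (fun s => a *: f s : S).
Proof.
move=> r0 pf; have := polylimM r0 (polylim_cst p r (a *: 1)) pf.
by rewrite normrZ norm_1 mulr1; apply: polylim_eq => s; rewrite -scalerAl mul1r.
Qed.

Lemma polylimN p r M f : 0 <= r -> polylim p r M f ->
  polylim p r M (fun s => - f s : S).
Proof.
move=> r0 /(polylimZ (-1) r0); rewrite normrN1 mul1r.
by apply: polylim_eq => s; rewrite scaleN1r.
Qed.

Lemma polylim_d_ds p r s M u : 0 < s -> s < r -> polylim p r M u ->
  polylim p s (M / (r - s)) (d_ds u) /\ polylim p s (M / (r - s)) (d_dsbar u).
Proof.
move=> s0 sr pu; have [_ dx dy] := polylim_differentiable s0 sr pu.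
have idy : polylim p s (M / (r - s)) (fun t => 'i%C * 'D_('i%C : S) u t : S).
  have := polylimM (ltW s0) (polylim_cst p s ('i%C : S)) dy.
  by rewrite norm_i mul1r.
have half : M / (r - s) = `|2^-1 : R| * (M / (r - s) + M / (r - s)).
  by rewrite ger0_norm ?invr_ge0//; field; rewrite subr_eq0 gt_eqF.
rewrite half; split; apply: polylimZ (ltW s0) _; apply: polylimD => //.
exact: polylimN (ltW s0) idy.
Qed.

(* [K] absorbs both Cauchy's estimate for the first order part (on a radius loss
   smaller than 1) and the bound on the potential [kappa]. *)
Lemma polylim_first_order p r s B K' M xi kappa u : 0 < s -> s < r -> r <= 1 ->
  polylim p s B (vf_s xi) -> polylim p s B (vf_sbar xi) -> polylim p s K' kappa ->
  polylim p r M u ->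
  polylim p s ((B + B + K') * (M / (r - s))) (fun t => vf_apply xi u t + kappa t * u t).
Proof.
move=> s0 sr r1 pb pc pk pu; have [du dbu] := polylim_d_ds s0 sr pu.
have rs0 : 0 < r - s by rewrite subr_gt0.
have M0 : 0 <= M by apply: polylim_ge0 pu; rewrite (le_trans (ltW s0))// ltW.
have pu' : polylim p s (M / (r - s)) u.
  apply: polylimW (ltW s0) (ltW sr) _ pu.
  by rewrite -[leLHS]mulr1 ler_wpM2l// invf_ge1// lerBlDr (le_trans r1)// lerDl ltW.
rewrite !mulrDl; apply: polylimD; last exact: polylimM (ltW s0) pk pu'.
by apply: polylimD; apply: polylimM => //; exact: ltW.
Qed.

(** Each letter of [w] costs a radius [d] and a factor [K / d]; the positivity hypothesis keeps all
    the intermediate radii positive. *)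
Lemma polylim_foldl (I : Type) (op : I -> (S -> S) -> S -> S) p r K M (w : seq I) u d :
  (forall i r' s M' v, 0 < s -> s < r' -> r' <= r -> polylim p r' M' v ->
     polylim p s (K * (M' / (r' - s))) (op i v)) ->
  0 < d -> 0 < r - (size w)%:R * d -> polylim p r M u ->
  polylim p (r - (size w)%:R * d) ((K / d) ^+ size w * M) (foldl (fun v i => op i v) u w).
Proof.
elim: w r M u => [|i w IHw] r M u opP d0 /=.
  by rewrite mul0r subr0 expr0 mul1r.
rewrite -natr1 mulrDl mul1r (addrC _ d) opprD addrA => rd pu.
have wd0 : 0 <= (size w)%:R * d by rewrite mulr_ge0// ltW.
have rd0 : 0 < r - d by rewrite (lt_le_trans rd)// gerBl.
have dr : r - d < r by rewrite gtrBl.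
have := IHw (r - d) (K * (M / d)) (op i u) _ d0 rd.
rewrite exprS (_ : _ * _ ^+ _ * M = (K / d) ^+ size w * (K * (M / d))); last by ring.
apply; first by move=> j r' s M' v s0 sr' r'r; apply: opP => //; rewrite (le_trans r'r)// ltW.
have := opP i r (r - d) M u rd0 dr (lexx r) pu.
by rewrite subKr.
Qed.

Lemma expnS_le_fact m : (m.+1 ^ m <= 4 ^ m * m`!)%N.
Proof.
apply: (@leq_trans ((m + m) ^_ m)).
  rewrite ffact_prod -[X in (_ ^ X <= _)%N]card_ord -prod_nat_const.
  by apply: leq_prod => i _; rewrite -addnBA ?(ltnW (ltn_ord i))// -addn1 leq_add2l subn_gt0.
rewrite -bin_ffact leq_mul2r; apply/orP; right.
rewrite -[4%N]/(2 ^ 2)%N -expnM mul2n -addnn -[2%N]/(1 + 1)%N expnDn.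
have mm : (m < (m + m).+1)%N by rewrite ltnS leq_addr.
by rewrite (bigD1 (Ordinal mm))//= !exp1n !muln1 leq_addr.
Qed.

(* The radius is lost in [(size w).+1] equal steps, which costs [m.+1 ^ m <= 4 ^ m * m`!]. *)
Lemma cauchy_iterates (I : Type) (op : I -> (S -> S) -> S -> S) p r K M u :
  0 < r -> 0 <= K ->
  (forall i r' s M' v, 0 < s -> s < r' -> r' <= r -> polylim p r' M' v ->
     polylim p s (K * (M' / (r' - s))) (op i v)) ->
  polylim p r M u -> forall (w : seq I) z, square_nbhs (r / 2) z ->
  `|foldl (fun v i => op i v) u w (p + z)| <= M * (8 * K / r) ^+ size w * (size w)`!%:R.
Proof.
move=> r0 K0 opP pu w z [zx zy]; set m := size w.
have M0 : 0 <= M by exact: polylim_ge0 (ltW r0) pu.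
(* The [m] losses together use at most half of the radius, and [m.+1] avoids a division by 0 for the
   empty word. Then [K / d] is [2 * K / r] times [m.+1]; with the 4 of [expnS_le_fact] this gives
   the 8. *)
pose d := r / (2 * m.+1%:R).
have d0 : 0 < d by rewrite divr_gt0// mulr_gt0.
have rd : r / 2 <= r - m%:R * d.
  rewrite /d -natr1 -subr_ge0 [X in 0 <= X](_ : _ = r / (2 * (m%:R + 1))).
    by rewrite divr_ge0 ?(ltW r0)// mulr_ge0// addr_ge0.
  by field; rewrite natr1 pnatr_eq0.
have rd0 : 0 < r - m%:R * d by rewrite (lt_le_trans _ rd)// divr_gt0.
have sz : square_nbhs (r - m%:R * d) z by split; exact: lt_le_trans rd.
apply: (le_trans (polylim_le (polylim_foldl opP d0 rd0 pu) sz)); rewrite -/m mulrC -mulrA.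
rewrite ler_wpM2l//.
rewrite (_ : K / d = (2 * K / r) * m.+1%:R); last first.
  by rewrite /d; field; rewrite nat1r pnatr_eq0 andbT gt_eqF.
rewrite (_ : 8 * K / r = (2 * K / r) * 4); last by field; rewrite gt_eqF.
rewrite exprMn [(_ * 4) ^+ m]exprMn -[leRHS]mulrA ler_wpM2l//.
  by rewrite exprn_ge0// divr_ge0 ?(ltW r0)// mulr_ge0.
by rewrite -!natrX -natrM ler_nat expnS_le_fact.
Qed.

Lemma near_square_nbhs p r : 0 < r -> \forall s \near p, square_nbhs r (s - p).
Proof.
move=> r0; near=> s; have sp : `|s - p| < r.
  by near: s; apply: cvgr_distC_lt => //; exact: cvg_id.
by split; [exact: le_lt_trans (Re_le_norm _) sp|exact: le_lt_trans (Im_le_norm _) sp].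
Unshelve. all: by end_near. Qed.

(** One parameter serves as bound and as inverse radius. The property then holds for all large [B],
    and finitely many functions are treated together by intersecting filters. *)
Lemma near_polylim f p : analytic_at f p -> \forall B \near +oo, polylim p B^-1 B f.
Proof.
move=> /analytic_at_polylim[r [M [r0 pf]]]; near=> B.
have B0 : 0 < B by near: B; apply: nbhs_pinfty_gt; exact: num_real.
have rB : r^-1 <= B by near: B; apply: nbhs_pinfty_ge; exact: num_real.
have MB : M <= B by near: B; apply: nbhs_pinfty_ge; exact: num_real.
apply: polylimW MB pf; first by rewrite invr_ge0 ltW.
by rewrite -[r in leRHS]invrK lef_pV2 ?posrE ?invr_gt0.
Unshelve. all: by end_near. Qed.

Definition first_order xi (kappa : S -> S) u : S -> S :=
  fun t => vf_apply xi u t + kappa t * u t.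

(** Stated along the product of the filters of [s] and [A], the form in which compactness yields one
    [A] for a whole compact set. *)
Lemma near_iterates_bound n (Xi : 'I_n -> vector_field R) (k : S -> S) (c l : S) p :
  (forall i, analytic_vf_at (Xi i) p) -> analytic_at k p ->
  \forall s \near p & A \near +oo, forall w : seq 'I_n,
   `|foldl (fun v i => first_order (Xi i)
        (fun t => l * (vf_s (Xi i) t * k t - vf_sbar (Xi i) t * conjc (k t))) v)
        (fun=> c) w s| <= A * A ^+ size w * (size w)`!%:R.
Proof.
move=> aXi ak.
have aXis : \forall B \near +oo, forall i, polylim p B^-1 B (vf_s (Xi i)).
  by apply: filter_forall => i; apply: near_polylim; have [] := aXi i.
have aXisb : \forall B \near +oo, forall i, polylim p B^-1 B (vf_sbar (Xi i)).
  by apply: filter_forall => i; apply: near_polylim; have [] := aXi i.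
near (pinfty_nbhs R) => B.
have B1 : 1 <= B by near: B; apply: nbhs_pinfty_ge; exact: num_real.
have pb i : polylim p B^-1 B (vf_s (Xi i)) by move: i; near: B.
have pc i : polylim p B^-1 B (vf_sbar (Xi i)) by move: i; near: B.
have pk : polylim p B^-1 B k by near: B; exact: near_polylim.
have B0 : 0 < B by rewrite (lt_le_trans _ B1).
pose K' := `|l| * (B * B + B * B); pose K := B + B + K'.
have K'0 : 0 <= K' by rewrite mulr_ge0// addr_ge0// mulr_ge0// ltW.
have K0 : 0 <= K by rewrite !addr_ge0// ltW.
have r0 : 0 < B^-1 by rewrite invr_gt0.
have opP i r' s M' v : 0 < s -> s < r' -> r' <= B^-1 -> polylim p r' M' v ->
    polylim p s (K * (M' / (r' - s))) (first_order (Xi i)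
      (fun t => l * (vf_s (Xi i) t * k t - vf_sbar (Xi i) t * conjc (k t))) v).
  move=> s0 sr rB pv; have sB : s <= B^-1 by rewrite (le_trans (ltW sr)).
  have restrict M f : polylim p B^-1 M f -> polylim p s M f.
    by apply: polylimW => //; exact: ltW.
  apply: polylim_first_order pv => //; try exact: restrict.
    by rewrite (le_trans rB)// invf_le1.
  apply: restrict; apply: polylimM (ltW r0) (polylim_cst _ _ _) _.
  apply: polylimD; first exact: polylimM (ltW r0) (pb i) pk.
  by apply: polylimN (ltW r0) _; apply: polylimM (ltW r0) (pc i) (polylim_conj pk).
have bound := cauchy_iterates r0 K0 opP (polylim_cst p B^-1 c).
near=> s A => w; have A0 : 0 <= A by near: A; apply: nbhs_pinfty_ge; exact: num_real.
have szs : square_nbhs (B^-1 / 2) (s - p).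
  by near: s; apply: near_square_nbhs; rewrite divr_gt0.
have := bound w _ szs; rewrite addrC subrK => /le_trans; apply.
have cA : `|c| <= A by near: A; apply: nbhs_pinfty_ge; exact: num_real.
have KA : 8 * K / B^-1 <= A by near: A; apply: nbhs_pinfty_ge; exact: num_real.
have KB0 : 0 <= 8 * K / B^-1 by rewrite divr_ge0 ?(ltW r0)// mulr_ge0.
by rewrite ler_wpM2r// ler_pM ?exprn_ge0// lerXn2r.
Unshelve. all: by end_near. Qed.

End cauchy_estimates.
(** * The smooth structure *)

Section vector_field_rules.
Context {R : realType}.
Local Notation C := R[i].
Local Notation S := (Rcomplex R).
Implicit Types (f g : S -> S) (xi eta : vector_field R) (s : S).

Lemma scaleSE (a : R) (x : S) : a *: x = (a%:C%C : C) * (x : C).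
Proof. by case: x => u v; rewrite /GRing.scale /GRing.mul /= !mul0r subr0 addr0. Qed.

(** All scalars are moved into the field [C]. The rules that follow then reduce to identities in
    generic complex numbers. *)
Lemma vf_applyE xi f s : vf_apply xi f s =
  ((2^-1 : R)%:C * (vf_s xi s * ('D_(1 : S) f s - 'i * 'D_('i%C : S) f s)
  + vf_sbar xi s * ('D_(1 : S) f s + 'i * 'D_('i%C : S) f s)))%C :> C.
Proof.
rewrite /vf_apply /d_ds /d_dsbar /d_ds_for /d_dsbar_for !scaleSE.
have E (h i a b c d : C) :
    a * (h * (c - i * d)) + b * (h * (c + i * d)) =
    h * (a * (c - i * d) + b * (c + i * d)) by ring.
exact: E.
Qed.

Lemma vf_applyD xi f g s : differentiable f s -> differentiable g s ->
  vf_apply xi (fun t => f t + g t) s = vf_apply xi f s + vf_apply xi g s :> C.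
Proof.
move=> df dg; rewrite !vf_applyE.
rewrite !(deriveD (f := f) (g := g)); try exact: diff_derivable.
have E (h i u v a b c d : C) :
    h * (u * (a + b - i * (c + d)) + v * (a + b + i * (c + d))) =
    h * (u * (a - i * c) + v * (a + i * c)) + h * (u * (b - i * d) + v * (b + i * d)).
  by ring.
exact: E.
Qed.

Lemma vf_applyM xi f g s : differentiable f s -> differentiable g s ->
  vf_apply xi (fun t => f t * g t) s =
  vf_apply xi f s * g s + f s * vf_apply xi g s :> C.
Proof.
move=> df dg; rewrite !vf_applyE.
rewrite !(derive_bilin mulS _ df dg) /=.
have E (h i u v a b c d x y : C) :
    h * (u * (a * y + x * b - i * (c * y + x * d)) +
         v * (a * y + x * b + i * (c * y + x * d))) =
    h * (u * (a - i * c) + v * (a + i * c)) * y +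
    x * (h * (u * (b - i * d) + v * (b + i * d))) by ring.
exact: E.
Qed.

Lemma vf_apply_cst xi (a : S) s : vf_apply xi (fun=> a) s = 0 :> C.
Proof. by rewrite vf_applyE !derive_cst mulr0 subr0 addr0 !mulr0 addr0 mulr0. Qed.

Lemma vf_apply_conj xi f s : differentiable f s ->
  vf_apply xi (fun t => conjc (f t)) s = conjc (vf_apply (vf_conj xi) f s) :> C.
Proof.
move=> df; rewrite !vf_applyE !(derive_op conj_op) //=.
have E (a b u v : C) :
    (2^-1 : R)%:C * (u * (conjc a - 'i * conjc b) + v * (conjc a + 'i * conjc b)) =
    conjc ((2^-1 : R)%:C * (conjc v * (a - 'i * b) + conjc u * (a + 'i * b))).
  move: a b u v => [a a'] [b b'] [u u'] [v v'].
  by apply/eqP; rewrite eq_complex /=; apply/andP; split; apply/eqP; ring.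
exact: E.
Qed.

Lemma vf_apply_sum xi n (f : nat -> S -> S) s : (forall i, differentiable (f i) s) ->
  vf_apply xi (fun t => \sum_(i < n) f i t) s = \sum_(i < n) (vf_apply xi (f i) s : C).
Proof.
move=> df.
have sumS m : (fun t => \sum_(i < m.+1) f i t) = (fun t => (\sum_(i < m) f i t) + f m t).
  by apply/funext => t; rewrite big_ord_recr.
have dsum m : differentiable (fun t => \sum_(i < m) f i t : S) s.
  elim: m => [|m IHm]; last by rewrite sumS; exact: differentiableD.
  by under eq_fun do rewrite big_ord0; exact: differentiable_cst.
elim: n => [|n IHn].
  by rewrite big_ord0; under eq_fun do rewrite big_ord0; exact: vf_apply_cst.
by rewrite big_ord_recr /= -IHn sumS vf_applyD.
Qed.

End vector_field_rules.

Section example_field.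
Context {R : realType}.
Local Notation C := R[i].
Local Notation S := (Rcomplex R).
Variables (H : S -> hilbertType R) (phi : nat -> hsection H) (k : S -> C).
Hypothesis phi_basis : forall s, orthonormal_basis (fun j => phi j s).
Hypothesis smooth_k : smooth_fun k.
Implicit Types (a b : nat -> S -> C) (xi eta : vector_field R) (s : S).

Local Notation comb := (combination phi).

Definition smooth_coefs a := forall l, smooth_fun (a l).

Definition potential eta l s : C :=
  l.+1%:R * (vf_s eta s * k s - vf_sbar eta s * conjc (k s)).

Definition coef_derivative eta a l s : C :=
  vf_apply eta (a l) s + potential eta l s * a l s.

(** [combination phi N a] determines [a] only up to the index [N]. Truncation is the normal form: it
    is what the inner products with the basis return, and it lets two combinations have the same
    length. *)
Definition truncation N a l : S -> C := if (l <= N)%N then a l else fun=> 0.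

Lemma combination_truncation N M a : (N <= M)%N -> comb M (truncation N a) = comb N a.
Proof.
move=> NM; apply: functional_extensionality_dep => s; rewrite /combination.
rewrite [RHS](big_ord_widen M.+1 (fun l => a l s *: phi l s))// [RHS]big_mkcond /=.
by apply: eq_bigr => l _; rewrite /truncation ltnS; case: ifP => // _; rewrite scale0r.
Qed.

Lemma smooth_truncation N a : smooth_coefs a -> smooth_coefs (truncation N a).
Proof. by move=> sa l; rewrite /truncation; case: ifP => // _; exact: smooth_fun_cst. Qed.

Lemma truncation_derivative N eta a :
  truncation N (coef_derivative eta a) = coef_derivative eta (truncation N a).
Proof.
apply/funext => l; rewrite /truncation /coef_derivative; case: ifP => // _.
by apply/funext => s; rewrite vf_apply_cst mulr0 addr0.
Qed.

Lemma combinations_common psi psi' :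
  combinations phi psi -> combinations phi psi' ->
  exists N a b, [/\ smooth_coefs a, smooth_coefs b, psi = comb N a & psi' = comb N b].
Proof.
move=> [N [a [sa ->]]] [M [b [sb ->]]]; exists (maxn N M), (truncation N a), (truncation M b).
by split; rewrite ?combination_truncation ?leq_maxl ?leq_maxr//; exact: smooth_truncation.
Qed.

Lemma inner_combination_basis N a l s :
  inner (comb N a s) (phi l s) = truncation N a l s.
Proof.
rewrite /combination linear_sumlz /=.
under eq_bigr do rewrite linearZl_LR /= (phi_basis s).1.
rewrite /truncation; case: ifPn => lN.
  rewrite (bigD1 (Ordinal (lN : (l < N.+1)%N)))//= eqxx mulr1 big1 ?addr0// => i il.
  by rewrite (_ : _ == l = false) ?mulr0//; apply: contra_neqF il => /eqP e; exact/val_inj.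
rewrite big1// => i _; rewrite (_ : _ == l = false) ?mulr0//.
by apply: contraNF lN => /eqP <-; rewrite -ltnS.
Qed.

Lemma inner_combination N a b s :
  inner (comb N a s) (comb N b s) = \sum_(l < N.+1) a l s * conjc (b l s).
Proof.
rewrite {2}/combination linear_sumr; apply: eq_bigr => l _ /=.
by rewrite linearZr_LR /= inner_combination_basis /truncation -ltnS ltn_ord mulrC.
Qed.

Lemma norm_basis l s : `|phi l s : realified (H s)| = 1.
Proof.
by rewrite -[LHS]/(Num.sqrt (complex.Re (inner (phi l s) (phi l s)))) (phi_basis s).1 eqxx sqrtr1.
Qed.

Lemma smooth_potential eta l : smooth_vf eta -> smooth_fun (potential eta l).
Proof.
move=> [s1 s2]; apply: smooth_funM; first exact: smooth_fun_cst.
apply: smooth_funD; first exact: smooth_funM.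
by apply/smooth_funN/smooth_funM => //; exact: smooth_fun_conj.
Qed.

Lemma smooth_coef_derivative eta a : smooth_vf eta -> smooth_coefs a ->
  smooth_coefs (coef_derivative eta a).
Proof.
move=> se sa l; apply: smooth_funD; first exact: smooth_vf_apply.
by apply: smooth_funM => //; exact: smooth_potential.
Qed.

(** The derivative must depend on the section and not on its presentation, so the coefficients are
    read off as inner products with the orthonormal basis. Sections that are not finite combinations
    get the arbitrary value [psi]. *)
Lemma exists_combination_derivative : exists nabla, combination_derivative phi k nabla.
Proof.
pose coef (psi : hsection H) l s : C := inner (psi s) (phi l s).
pose P psi N := psi = comb N (coef psi).
exists (fun eta psi => match pselect (exists N, P psi N) with
  | left h => comb (projT1 (cid h)) (coef_derivative eta (coef psi))
  | right _ => psi end) => eta N a se sa.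
have coefE M b : coef (comb M b) = truncation M b.
  by apply/funext => l; apply/funext => s; exact: inner_combination_basis.
case: pselect => [h|[]]; last first.
  by exists N; rewrite /P coefE combination_truncation.
case: (cid h) => M; rewrite /P /= => e.
(* The length [M] chosen for the section may differ from [N]; both sides are padded to the larger of
   the two. *)
have NM := leq_maxl N M; have MN := leq_maxr N M.
rewrite -[RHS]/(comb N (coef_derivative eta a)).
rewrite -(combination_truncation (coef_derivative eta a) NM).
rewrite -(combination_truncation (coef_derivative eta (coef (comb N a))) MN).
by rewrite !truncation_derivative -(coefE M) -e coefE.
Qed.

End example_field.

(** * Axioms of the smooth structure and analyticity of the basis *)

Section example_structure.
Context {R : realType}.
Local Notation C := R[i].
Local Notation S := (Rcomplex R).
Variables (H : S -> hilbertType R) (phi : nat -> hsection H) (k : S -> C).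
Hypothesis phi_basis : forall s, orthonormal_basis (fun j => phi j s).
Hypothesis smooth_k : smooth_fun k.
Variable nabla : vector_field R -> hsection H -> hsection H.
Hypothesis nablaE : combination_derivative phi k nabla.
Implicit Types (a b : nat -> S -> C) (xi eta : vector_field R) (s : S).

Local Notation comb := (combination phi).
Local Notation D := (coef_derivative k).

Lemma smooth_fun_diff (f : S -> S) s : smooth_fun f -> differentiable f s.
Proof. exact: smooth_diff. Qed.

Lemma nabla_combination eta N a : smooth_vf eta -> smooth_coefs a ->
  nabla eta (comb N a) = comb N (D eta a).
Proof. exact: nablaE. Qed.

Lemma eq_combination N a b : (forall l s, a l s = b l s) -> comb N a = comb N b.
Proof.
move=> ab; apply: functional_extensionality_dep => s.
by apply: eq_bigr => l _; rewrite ab.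
Qed.

Lemma combinationD N a b :
  hs_add (comb N a) (comb N b) = comb N (fun l s => a l s + b l s).
Proof.
apply: functional_extensionality_dep => s; rewrite /hs_add /combination -big_split.
by apply: eq_bigr => l _; rewrite scalerDl.
Qed.

Lemma combinationZ N (f : S -> C) a :
  hs_scale f (comb N a) = comb N (fun l s => f s * a l s).
Proof.
apply: functional_extensionality_dep => s; rewrite /hs_scale /combination scaler_sumr.
by apply: eq_bigr => l _; rewrite scalerA.
Qed.

Lemma smooth_coefsD a b : smooth_coefs a -> smooth_coefs b ->
  smooth_coefs (fun l s => a l s + b l s).
Proof. by move=> sa sb l; exact: smooth_funD. Qed.

Lemma smooth_coefsM (f : S -> C) a : smooth_fun f -> smooth_coefs a ->
  smooth_coefs (fun l s => f s * a l s).
Proof. by move=> sf sa l; exact: smooth_funM. Qed.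

Lemma combinations_combination N a : smooth_coefs a -> combinations phi (comb N a).
Proof. by move=> sa; exists N, a. Qed.

(** Constant coefficients already reach the span of the basis. Taking [P] arbitrary gives the
    density of smooth and of analytic sections at once. *)
Lemma combinations_dense_subset s (P : set (hsection H)) :
  (forall N (c : nat -> C), P (comb N (fun l _ => c l))) ->
  dense [set (psi s : realified (H s)) | psi in P].
Proof.
move=> PP; have [_ dB] := phi_basis s; move=> O O0 oO.
have [x [Ox [n [c xE]]]] := dB O O0 oO; exists x; split=> //.
(* [comb n] has [n.+1] terms, one more than the given sum, hence the zero coefficient. *)
exists (comb n (fun l _ => if (l < n)%N then c l else 0)) => //=.
rewrite xE /combination big_ord_recr /= ltnn scale0r addr0.
by apply: eq_bigr => l _; rewrite ltn_ord.
Qed.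

Lemma example_smooth_structure : smooth_structure (combinations phi) nabla.
Proof.
split.
- move=> psi psi' /combinations_common h /h[N [a [b [sa sb -> ->]]]].
  by rewrite combinationD; apply/combinations_combination/smooth_coefsD.
- move=> f _ sf [N [a [sa ->]]].
  by rewrite combinationZ; apply/combinations_combination/smooth_coefsM.
- move=> xi _ sxi [N [a [sa ->]]]; rewrite nabla_combination//.
  exact/combinations_combination/smooth_coef_derivative.
- move=> xi c psi psi' sxi /combinations_common h /h[N [a [b [sa sb -> ->]]]].
  have sc : smooth_fun (fun=> c : S) by exact: smooth_fun_cst.
  rewrite combinationZ combinationD !nabla_combination ?combinationZ ?combinationD//.
    apply: eq_combination => l s; rewrite /coef_derivative vf_applyD; last 2 first.
    + exact/smooth_fun_diff/smooth_funM.
    + exact/smooth_fun_diff/sb.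
    rewrite vf_applyM; [|exact: smooth_fun_diff|exact/smooth_fun_diff/sa].
    by rewrite vf_apply_cst; ring.
  by apply: smooth_coefsD => //; exact: smooth_coefsM.
- move=> xi eta _ sxi seta [N [a [sa ->]]].
  rewrite !nabla_combination ?combinationD//.
    by apply: eq_combination => l s; rewrite /coef_derivative /vf_apply /potential /=; ring.
  by case: sxi seta => ? ? [? ?]; split; exact: smooth_funD.
- move=> f xi _ sf sxi [N [a [sa ->]]].
  rewrite !nabla_combination ?combinationZ//.
    by apply: eq_combination => l s; rewrite /coef_derivative /vf_apply /potential /=; ring.
  by case: sxi => ? ?; split; exact: smooth_funM.
- move=> xi f _ sxi sf [N [a [sa ->]]].
  rewrite combinationZ !nabla_combination ?combinationZ ?combinationD//.
    apply: eq_combination => l s; rewrite /coef_derivative.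
    rewrite vf_applyM; [|exact: smooth_fun_diff|exact/smooth_fun_diff/sa].
    by ring.
  exact: smooth_coefsM.
- move=> psi psi' /combinations_common h /h[N [a [b [sa sb -> ->]]]].
  have -> : hs_inner (comb N a) (comb N b) =
      (fun s => \sum_(l < N.+1) a l s * conjc (b l s)).
    by apply/funext => s; exact: inner_combination.
  by apply: (@smooth_fun_sum _ N.+1 (fun l s => a l s * conjc (b l s))) => l;
     apply: smooth_funM => //; exact: smooth_fun_conj.
- move=> xi psi psi' s sxi /combinations_common h /h[N [a [b [sa sb -> ->]]]].
  have sxi' : smooth_vf (vf_conj xi).
    by case: sxi => ? ?; split; exact: smooth_fun_conj.
  have -> : hs_inner (comb N a) (comb N b) =
      (fun s => \sum_(l < N.+1) a l s * conjc (b l s)).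
    by apply/funext => t; exact: inner_combination.
  rewrite (vf_apply_sum _ _ (f := fun l s => a l s * conjc (b l s))); last first.
    by move=> l; apply/smooth_fun_diff/smooth_funM => //; exact: smooth_fun_conj.
  rewrite !nabla_combination// /hs_inner !inner_combination// -big_split /=.
  apply: eq_bigr => l _; rewrite vf_applyM; last 2 first.
  + exact/smooth_fun_diff/sa.
  + exact/smooth_fun_diff/smooth_fun_conj.
  rewrite vf_apply_conj; last exact/smooth_fun_diff/sb.
  (* The potential of [xi] and the conjugate of that of [vf_conj xi] are opposite, so only the
     Leibniz terms remain. *)
  rewrite /coef_derivative /potential /=.
  rewrite !(rmorphD, rmorphM, rmorphN, rmorph_nat) /= !conjcK.
  by ring.
- move=> s; apply: combinations_dense_subset => N c.
  by apply: combinations_combination => l; exact: smooth_fun_cst.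
Qed.

Lemma norm_scale (V : hilbertType R) (c : C) (x : V) :
  `|c *: x : realified V| = `|c : S| * `|x : realified V|.
Proof.
rewrite -[LHS]/(Num.sqrt (complex.Re (inner (c *: x) (c *: x)))) dnormZ -inner_real.
rewrite -[`|c|%R]/((`|c : S|)%:C)%C -rmorphXn -rmorphM /=.
by rewrite sqrtrM ?sqr_ge0// sqrtr_sqr ger0_norm.
Qed.

(* The sum is taken in [V], where [ler_norm_sum] does not apply. *)
Lemma norm_sum_le (V : hilbertType R) n (u : nat -> V) :
  `|\sum_(l < n) u l : realified V| <= \sum_(l < n) `|u l : realified V|.
Proof.
elim: n => [|n IHn]; first by rewrite !big_ord0 (@normr0 R (realified V)).
rewrite !big_ord_recr /=; apply: le_trans (@hilbert_normD R V _ _) _.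
by rewrite lerD2r.
Qed.

Lemma norm_combination_le N a s :
  `|comb N a s : realified (H s)| <= \sum_(l < N.+1) `|a l s : S|.
Proof.
apply: (le_trans (norm_sum_le _ (fun l => a l s *: phi l s))); apply: ler_sum => l _.
by rewrite norm_scale (norm_basis phi_basis) mulr1.
Qed.

Lemma foldl_nabla n (Xi : 'I_n -> vector_field R) (w : seq 'I_n) N a :
  (forall i, smooth_vf (Xi i)) -> smooth_coefs a ->
  foldl (fun psi i => nabla (Xi i) psi) (comb N a) w =
  comb N (fun l => foldl (fun v i => first_order (Xi i) (potential k (Xi i) l) v) (a l) w).
Proof.
move=> sXi; elim: w a => [//|i w IHw] a sa /=.
rewrite nabla_combination// IHw//; exact: smooth_coef_derivative.
Qed.

Lemma constant_combination_analytic N (c : nat -> C) :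
  (forall s, analytic_at k s) ->
  analytic_section (combinations phi) nabla (comb N (fun l _ => c l)).
Proof.
move=> ak; split=> [|K n Xi cK sXi aXi].
  by apply: combinations_combination => l; exact: smooth_fun_cst.
pose bounded (l : 'I_N.+1) (A : R) s := forall w : seq 'I_n,
    `|foldl (fun v i => first_order (Xi i) (potential k (Xi i) l) v) (fun=> c l) w s : S| <=
    A * A ^+ size w * (size w)`!%:R.
have bound : \forall A \near +oo, K `<=` (fun s => forall l, bounded l A s).
  have /compact_near_coveringP cover := cK.
  apply: (cover R (pinfty_nbhs R) (fun A s => forall l, bounded l A s)) => p Kp.
  have near_l (l : 'I_N.+1) :
      \forall x \near filter_prod (nbhs p) (pinfty_nbhs R), bounded l x.2 x.1.
    apply: (@near_iterates_bound R n Xi k (c l) l.+1%:R p) => // i.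
    by case: (aXi i) => O [_ KO aO]; apply: aO; exact: KO.
  exact: (filter_forall _ near_l).
near (pinfty_nbhs R) => A.
have A0 : 0 < A by near: A; apply: nbhs_pinfty_gt; exact: num_real.
(* This radius cancels the factor [A ^+ size w], and the factorials cancel too, leaving [A] for each
   of the [N.+1] terms. *)
exists A^-1; first by rewrite invr_gt0.
exists (\sum_(l < N.+1) A) => w s Ks.
rewrite foldl_nabla//; last by move=> l; exact: smooth_fun_cst.
have f0 : 0 < A^-1 ^+ size w / (size w)`!%:R.
  by rewrite divr_gt0 ?exprn_gt0 ?invr_gt0// ltr0n fact_gt0.
rewrite (le_trans (ler_wpM2l (ltW f0) (norm_combination_le _ _ _)))//.
rewrite mulr_sumr; apply: ler_sum => l _.
have KA : K `<=` (fun s => forall l, bounded l A s) by near: A.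
rewrite (le_trans (ler_wpM2l (ltW f0) (KA s Ks l w)))//.
have -> : A^-1 ^+ size w / (size w)`!%:R * (A * A ^+ size w * (size w)`!%:R) =
    A * ((A^-1 * A) ^+ size w) * ((size w)`!%:R^-1 * (size w)`!%:R).
  by rewrite exprMn; ring.
by rewrite !mulVf ?gt_eqF// ?expr1n ?mulr1// ltr0n fact_gt0.
Unshelve. all: by end_near. Qed.

Lemma basis_combination j : phi j = comb j (fun l _ => (l == j)%:R).
Proof.
apply: functional_extensionality_dep => s; rewrite /combination (bigD1 ord_max)//=.
rewrite eqxx scale1r big1 ?addr0// => l lj.
by rewrite (_ : _ == j = false) ?scale0r//; apply: contra_neqF lj => /eqP e; exact/val_inj.
Qed.

End example_structure.
(** * Symmetry of second derivatives *)

Section second_derivatives.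
Context {R : realType}.
Local Notation S := (Rcomplex R).

Lemma differentiable_near_eq (E F : normedModType R) (f g : E -> F) (x : E) :
  (\near x, f x = g x) -> differentiable f x -> differentiable g x.
Proof.
move=> fg df; have fgx := nbhs_singleton fg.
suff [] : is_diff x g ('d f x) by [].
apply: is_diff_eps => [|e e0]; first exact: diff_continuous.
have /diff_locally/eqaddoP/(_ e e0) := df.
have fg0 : \forall h \near 0, f (h + x) = g (h + x).
  by have := fg; rewrite (near_shift 0); apply: filterS => h; rewrite /= subr0.
move=> fo; near=> h; rewrite -fgx -(_ : f (h + x) = g (h + x)); last by near: h.
rewrite (_ : f (h + x) - f x - 'd f x h =
  (f \o shift x - (cst (f x) + 'd f x)) h); first by near: h.
by rewrite !fctE /= opprD addrA.
Unshelve. all: by end_near. Qed.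

Lemma is_derive_line (E : normedModType R) (f : E -> R) (q u : E) (t : R) :
  differentiable f (q + t *: u) ->
  is_derive t 1 (fun t => f (q + t *: u)) ('D_u f (q + t *: u)).
Proof.
move=> df; have du : derivable f (q + t *: u) u by exact: diff_derivable.
have e : (fun h : R => h^-1 *: (f (h *: u + (q + t *: u)) - f (q + t *: u))) =
    (fun h : R => h^-1 *: (f (q + (h *: 1 + t) *: u) - f (q + t *: u))).
  by apply/funext => h; rewrite addrCA scalerDl -scalerA scale1r.
by split; rewrite /derivable /derive -?e.
Qed.

Section mixed_difference.
Context {E : normedModType R} (f : E -> R) (p u v : E) (a : E -> R).

Definition mixed_difference (t : R) : R :=
  f (p + t *: v + t *: u) - f (p + t *: u) - (f (p + t *: v) - f p).

(** The mean value theorem along [u], applied to the increment of [f] by [t *: v], gives [t] times a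
    difference of values of [a]. These are expanded at [p], at points displaced by at most
    [t * (|u| + |v|)] and [t * |u|] in norm, whence the constant. *)
Lemma mixed_difference_le e : 0 < e ->
  (\forall s \near p, differentiable f s /\ 'D_u f s = a s) -> differentiable a p ->
  \forall t \near 0^'+, `|mixed_difference t - t ^+ 2 * 'D_v a p| <=
    e * (2 * `|u| + `|v|) * t ^+ 2.
Proof.
move=> e0 fa da; have near0 : \forall h \near 0, [/\ differentiable f (h + p),
    'D_u f (h + p) = a (h + p) & `|a (h + p) - a p - 'd a p h| <= e * `|h|].
  have /diff_locally/eqaddoP/(_ e e0) ao := da.
  have fa0 : \forall h \near 0, differentiable f (h + p) /\ 'D_u f (h + p) = a (h + p).
    by have := fa; rewrite (near_shift 0); apply: filterS => h; rewrite /= subr0.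
  near=> h; have [] : differentiable f (h + p) /\ 'D_u f (h + p) = a (h + p) by near: h.
  move=> ? ?; split=> //; rewrite (_ : a (h + p) - a p - 'd a p h =
    (a \o shift p - (cst (a p) + 'd a p)) h); first by near: h.
  by rewrite !fctE /= opprD addrA.
have /nbhs_norm0P[d /= d0 dP] := near0.
near=> t; have t0 : 0 < t by [].
have td : t * (`|u| + `|v|) < d.
  have t1 : t < d / (`|u| + `|v| + 1).
    by near: t; apply: nbhs_right_lt; rewrite divr_gt0// ltr_wpDl// addr_ge0.
  rewrite (@le_lt_trans _ _ (t * (`|u| + `|v| + 1)))//.
    by rewrite ler_wpM2l ?(ltW t0)// lerDl.
  by rewrite -ltr_pdivlMr// ltr_wpDl// addr_ge0.
have small x : 0 <= x <= t -> `|x *: u| < d /\ `|t *: v + x *: u| < d.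
  move=> /andP[x0 xt].
  have le_xu : `|x *: u| <= t * `|u| by rewrite normrZ ger0_norm// ler_wpM2r.
  split; apply: le_lt_trans td.
    by rewrite mulrDr (le_trans le_xu)// lerDl mulr_ge0 ?(ltW t0).
  rewrite (le_trans (ler_normD _ _))// mulrDr addrC lerD//.
  by rewrite normrZ gtr0_norm.
pose F x : R := f (p + t *: v + x *: u) - f (p + x *: u).
have dF x : 0 <= x <= t -> is_derive x 1 F
    ('D_u f (p + t *: v + x *: u) - 'D_u f (p + x *: u)).
  move=> /small[/dP[+ _ _] /dP[+ _ _]]; rewrite addrC => d2; rewrite addrC addrA => d1.
  by have := is_derive_line d1; have := is_derive_line d2 => h1 h2; exact: is_deriveB.
have [x||c] := @MVT R F (fun x => 'D_u f (p + t *: v + x *: u) - 'D_u f (p + x *: u)) 0 t t0.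
- by rewrite in_itv /= => /andP[x0 xt]; apply: dF; rewrite !ltW.
- apply: derivable_within_continuous => x; rewrite in_itv /= => xt.
  by case: (dF x xt).
rewrite in_itv /= subr0 => /andP[c0 ct].
have cI : 0 <= c <= t by rewrite !ltW.
have [/dP[_ e1 b1] /dP[_ e2 b2]] := small c cI.
rewrite (_ : F t - F 0 = mixed_difference t); last first.
  by rewrite /F /mixed_difference !scale0r !addr0.
rewrite (_ : p + t *: v + c *: u = t *: v + c *: u + p); last by rewrite -addrA addrC.
rewrite (addrC p (c *: u)) e1 e2 => ->.
rewrite (_ : _ - _ = ((a (t *: v + c *: u + p) - a p - 'd a p (t *: v + c *: u)) -
    (a (c *: u + p) - a p - 'd a p (c *: u))) * t); last first.
  have -> : 'd a p (t *: v + c *: u) = t * 'd a p v + 'd a p (c *: u).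
    by rewrite linearD linearZ.
  by rewrite deriveE//; ring.
rewrite normrM (gtr0_norm t0) expr2 mulrA ler_wpM2r ?(ltW t0)//.
apply: (le_trans (ler_normB _ _)); apply: (le_trans (lerD b2 b1)).
rewrite -mulrDr -mulrA ler_wpM2l ?(ltW e0)//.
have le_cu : `|c *: u| <= t * `|u| by rewrite normrZ ger0_norm ?ler_wpM2r// ltW.
have le_tv : `|t *: v| = t * `|v| by rewrite normrZ gtr0_norm.
apply: (@le_trans _ _ (t * `|v| + t * `|u| + t * `|u|)); last first.
  by rewrite le_eqVlt; apply/orP; left; apply/eqP; ring.
by rewrite lerD// (le_trans (ler_normD _ _))// lerD// le_tv.
Unshelve. all: by end_near. Qed.

End mixed_difference.

(** The second difference is symmetric in [u] and [v], and divided by [t ^+ 2] it approximates both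
    mixed derivatives. *)
Lemma mixed_derivatives_eq (E : normedModType R) (f a b : E -> R) (p u v : E) :
  (\forall s \near p, [/\ differentiable f s, 'D_u f s = a s & 'D_v f s = b s]) ->
  differentiable a p -> differentiable b p -> 'D_v a p = 'D_u b p.
Proof.
move=> fab da db; apply/eqP; rewrite -subr_eq0 -normr_le0; apply/ler_addgt0Pl => e e0.
(* The two error constants add up to three times the sum of the norms; the 1 makes [c] positive when
   both vectors vanish. *)
pose c := 3 * (`|u| + `|v|) + 1; have c0 : 0 < c by rewrite ltr_wpDl// mulr_ge0// addr_ge0.
have ec : 0 < e / c by rewrite divr_gt0.
have fa : \forall s \near p, differentiable f s /\ 'D_u f s = a s.
  by apply: filterS fab => s [].
have fb : \forall s \near p, differentiable f s /\ 'D_v f s = b s.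
  by apply: filterS fab => s [].
have na := mixed_difference_le v ec fa da; have nb := mixed_difference_le u ec fb db.
near (0 : R)^'+ => t; have t0 : 0 < t by [].
have ha : `|mixed_difference f p u v t - t ^+ 2 * 'D_v a p| <=
    e / c * (2 * `|u| + `|v|) * t ^+ 2 by near: t.
have hb : `|mixed_difference f p v u t - t ^+ 2 * 'D_u b p| <=
    e / c * (2 * `|v| + `|u|) * t ^+ 2 by near: t.
have dC : mixed_difference f p v u t = mixed_difference f p u v t.
  by rewrite /mixed_difference (addrAC p (t *: u)); ring.
rewrite addr0 -(@ler_pM2r _ (t ^+ 2)) ?exprn_gt0//.
rewrite -[t ^+ 2 in leLHS]ger0_norm ?sqr_ge0// -normrM.
rewrite (_ : _ * _ = (mixed_difference f p v u t - t ^+ 2 * 'D_u b p) -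
  (mixed_difference f p u v t - t ^+ 2 * 'D_v a p)); last by rewrite dC; ring.
apply: (le_trans (ler_normB _ _)); apply: (le_trans (lerD hb ha)).
rewrite -mulrDl ler_wpM2r ?sqr_ge0// -mulrDr -mulrA ler_piMr ?(ltW e0)//.
rewrite mulrC ler_pdivrMr// mul1r /c; have := normr_ge0 u; have := normr_ge0 v; lra.
Unshelve. all: by end_near. Qed.

Section hilbert_valued.
Variable X : hilbertType R.

Lemma Re_inner_linear (w : X) : linear (fun x : realified X => complex.Re (inner (x : X) w)).
Proof.
move=> a x y; rewrite -[a *: x + y]/((a%:C)%C *: (x : X) + (y : X)) linearDl linearZl_LR /=.
by case: (inner _ _) (inner _ _) => c d [c' d'] /=; rewrite mul0r subr0.
Qed.

Lemma Re_inner_subproof (w : X) :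
  (fun x : realified X => complex.Re (inner (x : X) w)) \in
  @continuous_linear R (realified X) R.
Proof.
apply: continuous_linearP; first exact: Re_inner_linear.
exists `|w : realified X| => x; rewrite ler_norml mulrC; apply/andP; split.
  pose y : X := x; have := @Re_inner_le R X (- y) w; rewrite linearNl lerNl.
  have -> : complex.Re (- inner y w) = - complex.Re (inner y w) by case: (inner y w).
  by rewrite -[hilbert_norm (- y)]/(`|- x|) normrN.
exact: Re_inner_le.
Qed.

Definition Re_inner (w : X) := BoundedOperator (Re_inner_subproof w).

Lemma Re_inner_eq (x y : realified X) : (forall w, Re_inner w x = Re_inner w y) -> x = y.
Proof.
move=> xy; apply/eqP; rewrite -subr_eq0; apply/eqP/hilbert_norm_eq0.
rewrite /hilbert_norm -[complex.Re _]/(Re_inner (x - y) (x - y)).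
have -> : Re_inner (x - y) (x - y) = Re_inner (x - y) x - Re_inner (x - y) y.
  exact: linearB.
by rewrite xy subrr sqrtr0.
Qed.

(** The mean value theorem is a statement on real functions, so the symmetry is tested against the
    functionals [Re_inner w], which separate points. *)
Lemma mixed_derivatives_eq_hilbert (E : normedModType R) (f a b : E -> realified X) (p u v : E) :
  (\forall s \near p, [/\ differentiable f s, 'D_u f s = a s & 'D_v f s = b s]) ->
  differentiable a p -> differentiable b p -> 'D_v a p = 'D_u b p.
Proof.
move=> fab da db; apply: Re_inner_eq => w; rewrite -!derive_op//.
have rw (g : E -> realified X) q :
    differentiable g q -> differentiable (fun t => Re_inner w (g t)) q.
  by move=> dg; case: (is_diff_op (Re_inner w) dg).
apply: (@mixed_derivatives_eq E (fun t => Re_inner w (f t))); [|exact: rw|exact: rw].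
by apply: filterS fab => s [df <- <-]; split; [exact: rw|exact: derive_op|exact: derive_op].
Qed.

End hilbert_valued.
End second_derivatives.
(** * Curvature *)

Section curvature.
Context {R : realType}.
Local Notation S := (Rcomplex R).
Variable X : hilbertType R.
Local Notation V := (realified X).

Lemma mul_i_subproof : (fun x : V => 'i%C *: (x : X) : V) \in @continuous_linear R V V.
Proof.
apply: continuous_linearP => [a x y|].
  rewrite -[a *: x + y]/((a%:C)%C *: (x : X) + (y : X)) scalerDr !scalerA mulrC.
  by rewrite -scalerA.
by exists 1 => x; rewrite norm_scale norm_i.
Qed.

Definition mul_i := BoundedOperator mul_i_subproof.

Lemma norm_mul_i x : `|mul_i x| = `|x|.
Proof. by rewrite [LHS]norm_scale norm_i mul1r. Qed.

Lemma mul_iK x : mul_i (mul_i x) = - x.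
Proof.
rewrite /mul_i /= scalerA (_ : 'i * 'i = -1)%C ?scaleN1r//.
by apply/eqP; rewrite eq_complex /= !mul0r !mulr0 mul1r sub0r addr0 oppr0 !eqxx.
Qed.

(* The covariant derivatives along the coordinate directions commute up to
   [l * laplacian g] on [u], while their commutator is that of the connection
   matrices [P] and [Q]. *)
Lemma curvature_le (u : S -> V) (P Q : S -> bounded_operator V V) (g : S -> R) (l : R) p :
  (\forall s \near p, [/\ differentiable u s,
    'D_(1 : S) u s = - (l * 'D_('i%C : S) g s) *: mul_i (u s) - P s (u s) &
    'D_('i%C : S) u s = (l * 'D_(1 : S) g s) *: mul_i (u s) - Q s (u s)]) ->
  differentiable ('D_(1 : S) g) p -> differentiable ('D_('i%C : S) g) p ->
  differentiable P p -> differentiable Q p ->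
  (forall x, P p (mul_i x) = mul_i (P p x)) ->
  (forall x, Q p (mul_i x) = mul_i (Q p x)) ->
  `|u p| = 1 ->
  `|l * laplacian g p| <=
    `|'D_('i%C : S) P p| + `|'D_(1 : S) Q p| + 2 * (`|P p| * `|Q p|).
Proof.
move=> Du dgx dgy dP dQ PJ QJ u1.
have [du ux uy] := nbhs_singleton Du.
(* The equations express the first derivatives of [u] through [u] itself, hence as maps that are
   again differentiable at [p]. *)
pose a s : V := (- l * 'D_('i%C : S) g s) *: mul_i (u s) - P s (u s).
pose b s : V := (l * 'D_(1 : S) g s) *: mul_i (u s) - Q s (u s).
have dJu : differentiable (fun s => mul_i (u s)) p by case: (is_diff_op mul_i du).
have dJ v : 'D_v (fun s => mul_i (u s)) p = mul_i ('D_v u p) by exact: derive_op.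
have dl (f : S -> R) c v : differentiable f p ->
    is_derive p v (fun s => (c * f s) *: mul_i (u s))
      ((c * 'D_v f p) *: mul_i (u p) + (c * f p) *: mul_i ('D_v u p)).
  move=> df; have dcf : differentiable (fun s => c * f s) p by exact: differentiableZ.
  apply: DeriveDef.
    by apply: diff_derivable; exact: (differentiable_bounded_bilin scale_bilin dcf dJu).
  rewrite (derive_bilin scale_bilin _ dcf dJu) /= dJ; congr (_ *: _ + _).
  by rewrite (deriveZ (f := f))//; exact: diff_derivable.
have dop (T : S -> bounded_operator V V) v : differentiable T p ->
    is_derive p v (fun s => T s (u s)) ('D_v T p (u p) + T p ('D_v u p)).
  move=> dT; apply: DeriveDef.
    by apply: diff_derivable; exact: (differentiable_bounded_bilin op_app dT du).
  exact: (derive_bilin op_app _ dT du).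
have da : differentiable a p.
  apply: differentiableB; last exact: (differentiable_bounded_bilin op_app dP du).
  by apply: (differentiable_bounded_bilin scale_bilin) => //; exact: differentiableZ.
have db : differentiable b p.
  apply: differentiableB; last exact: (differentiable_bounded_bilin op_app dQ du).
  by apply: (differentiable_bounded_bilin scale_bilin) => //; exact: differentiableZ.
have /eqP : 'D_('i%C : S) a p = 'D_(1 : S) b p.
  apply: mixed_derivatives_eq_hilbert da db.
  by apply: filterS Du => s [ds e1 e2]; split; [exact: ds|by rewrite e1 /a mulNr|exact: e2].
have [_ ->] := is_deriveB (dl ('D_('i%C : S) g) (- l) ('i%C : S) dgy) (dop P ('i%C : S) dP).
have [_ ->] := is_deriveB (dl ('D_(1 : S) g) l (1 : S) dgx) (dop Q (1 : S) dQ).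
rewrite ux uy.
set gx := 'D_1 g p; set gy := 'D_('i%C : S) g p.
set gxx := 'D_1 ('D_1 g) p; set gyy := 'D_('i%C : S) ('D_('i%C : S) g) p.
set J := mul_i; set U := u p.
have opB (L : bounded_operator V V) x y : L (x - y) = L x - L y by exact: linearB.
have opZ (L : bounded_operator V V) (c : R) x : L (c *: x) = c *: L x by exact: linearZ.
rewrite !(opB mul_i, opB (P p), opB (Q p)).
rewrite !(opZ mul_i, opZ (P p), opZ (Q p)).
rewrite !PJ !QJ !mul_iK => /eqP E.
have opU (L : bounded_operator V V) : `|L U| <= `|L|.
  by rewrite -[leRHS]mulr1 -u1; exact: bounded_operatorP.
have opUU (L L' : bounded_operator V V) : `|L (L' U)| <= `|L| * `|L'|.
  by apply: (le_trans (bounded_operatorP _ _)); rewrite ler_wpM2l.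
rewrite (_ : `|l * _| = `|(l * (gxx + gyy)) *: mul_i U|); last first.
  by rewrite [RHS]normrZ norm_mul_i u1 mulr1.
rewrite (_ : _ *: _ = ('D_(1 : S) Q p U - 'D_('i%C : S) P p U) +
    (P p (Q p U) - Q p (P p U))).
  apply: (le_trans (ler_normD _ _)).
  apply: (le_trans (lerD (ler_normB _ _) (ler_normB _ _))).
  rewrite [in leRHS]addrC [X in _ <= X]addrC lerD//.
    by rewrite addrC lerD.
  by rewrite mulr_natl mulr2n lerD// mulrC.
apply: Re_inner_eq => w; move/(congr1 (Re_inner w)): E.
have rD x y : Re_inner w (x + y) = Re_inner w x + Re_inner w y by exact: linearD.
have rN x : Re_inner w (- x) = - Re_inner w x by exact: linearN.
have rZ (c : R) x : Re_inner w (c *: x) = c * Re_inner w x by exact: linearZ.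
rewrite !(rD, rN, rZ).
(* Since [P p] and [Q p] commute with multiplication by [i], all terms in the first derivatives of
   [g] occur on both sides and cancel. *)
have key (x y xx yy ju ru jq jp dp dq pq qp : R) :
    - l * yy * ju + - l * y * (l * x * - ru - jq) - (dp + (l * x * jp - pq)) =
    l * xx * ju + l * x * (- (l * y) * - ru - jp) - (dq + (- (l * y) * jq - qp)) ->
    l * (xx + yy) * ju = dq - dp + (pq - qp).
  by lra.
exact: key.
Qed.

End curvature.

(** * Sections and derivatives in a local trivialization *)

Section trivialized_sections.
Context {R : realType}.
Local Notation C := R[i].
Local Notation S := (Rcomplex R).

(** Smoothness is known in charts only, so the composite is factored near [s] through a chart of the
    total space around the value of the section. *)
Lemma trivialized_section_differentiable (B : hilbert_bundle) (U : set S)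
    (X : hilbertType R) (FU : total_space B -> realified X) (psi : bsection B) s :
  local_trivialization U FU -> smooth_section psi -> U s ->
  differentiable (fun t => FU (fiber_incl (psi t))) s.
Proof.
move=> [oU [_ FUs] _ _] [sc ss] Us; pose sigma t := fiber_incl (psi t).
have psig t : bundle_proj (sigma t) = t.
  have : range (@fiber_incl R B t) (sigma t) by exists (psi t).
  by rewrite fiber_incl_im.
have [c ac ce] := atlas_cover (sigma s).
have [ds [sd _]] := ss (id_chart S) c erefl ac 1%N.
have [df [fd _]] := FUs c (id_chart (realified X)) ac erefl 1%N.
have ds1 : differentiable (chart_map c \o sigma) s.
  by have [] := sd s; [exists s|].
have df1 : differentiable (FU \o chart_inv (b:=c)) (chart_map c (sigma s)).
  have [] // := fd (chart_map c (sigma s)).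
  by exists (sigma s) => //; split=> //; split=> //; rewrite /= psig.
have := differentiable_comp ds1 df1; apply: differentiable_near_eq.
have : \forall t \near s, chart_dom c (sigma t).
  by apply: (sc s I); apply: open_nbhs_nbhs; split=> //; exact: chart_dom_open.
by apply: filterS => t ct /=; rewrite chart_mapK.
Qed.

Lemma linear_scale (U V : lmodType C) (f : U -> V) : linear f -> scalable f.
Proof.
move=> lf a x; have f0 : f 0 = 0.
  by have := lf (-1) 0 0; rewrite scaler0 addr0 scaleN1r addNr.
by have := lf a x 0; rewrite f0 !addr0.
Qed.

Lemma smooth_vf_cst (a b : C) : smooth_vf (@VectorField R (fun=> a) (fun=> b)).
Proof. by split; exact: smooth_fun_cst. Qed.

(** In real coordinates, [d/dx] is [d/ds + d/dsbar] and [d/dy] is [i (d/ds - d/dsbar)]. *)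
Lemma real_directions (X : hilbertType R) (u : S -> realified X) s :
  vf_apply_vec (VectorField (fun=> 1) (fun=> 1)) u s = 'D_(1 : S) u s /\
  vf_apply_vec (VectorField (fun=> 'i%C) (fun=> - 'i%C)) u s = 'D_('i%C : S) u s.
Proof.
have half (x : realified X) : 2^-1 *: (x + x) = x.
  by rewrite scalerDr -scalerDl (_ : 2^-1 + 2^-1 = 1) ?scale1r//; lra.
set a := 'D_1 u s; set b := 'D_'i u s.
have opB (x y : realified X) : mul_i X (x - y) = mul_i X x - mul_i X y by exact: linearB.
split.
  rewrite /vf_apply_vec /d_ds_for /d_dsbar_for /cscale /= !scale1r -/a -/b.
  rewrite -[LHS]scalerDr -[X in 2^-1 *: X](_ : a + a = _) ?half//.
  by rewrite addrACA [- _ + _]addrC subrr addr0.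
rewrite -[LHS]/(mul_i X (2^-1 *: (a - mul_i X b)) + - 'i%C *: (2^-1 *: (a + mul_i X b) : X)).
rewrite scaleNr -[LHS]opB -scalerBr opprD addrACA subrr add0r -opprD scalerN half.
by rewrite -(sub0r (mul_i X b)) opB mul_iK opprK -[X in X + _]/(mul_i X 0) linear0 add0r.
Qed.

Lemma derive_real_complex (g : S -> R) v s : smooth_fun (fun t => (g t)%:C%C) ->
  'D_v (fun t => (g t)%:C%C : S) s = ('D_v g s)%:C%C.
Proof.
move=> sg; have dg := smooth_fun_diff s sg.
have := derive_op (@Re_op R) v dg; have := derive_op (@Im_op R) v dg => /=.
rewrite derive_cst; case: ('D_v _ s) => a b /= <- e.
by congr (_ +i* _)%C; rewrite -e.
Qed.

Lemma smooth_real_part (g : S -> R) : smooth_fun (fun t => (g t)%:C%C) ->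
  @smooth_on R S R setT g.
Proof. by move=> sg n; exact: (Ck_linear (@Re_op R) (sg n)). Qed.

End trivialized_sections.

(** * The obstruction to being induced from a hermitian bundle *)

Section example_not_induced.
Context {R : realType}.
Local Notation C := R[i].
Local Notation S := (Rcomplex R).
Variables (H : S -> hilbertType R) (phi : nat -> hsection H) (k : S -> C).
Hypothesis phi_basis : forall s, orthonormal_basis (fun j => phi j s).
Hypothesis smooth_k : smooth_fun k.
Variable nabla : vector_field R -> hsection H -> hsection H.
Hypothesis nablaE : combination_derivative phi k nabla.
Variable g : S -> R.
Hypothesis smooth_g : smooth_fun (fun t => (g t)%:C%C).
Hypothesis kE : forall s, k s = d_ds (fun t => (g t)%:C%C) s.

Lemma nabla_basis eta j s : smooth_vf eta ->
  nabla eta (phi j) s = potential k eta j s *: phi j s.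
Proof.
move=> se; rewrite (basis_combination phi j) (nabla_combination nablaE)//; last first.
  by move=> l; exact: smooth_fun_cst.
rewrite /combination (bigD1 ord_max)//= big1.
  rewrite /coef_derivative vf_apply_cst add0r eqxx mulr1 addr0.
  rewrite (bigD1 ord_max)//= big1 ?eqxx ?scale1r ?addr0// => l lj.
  by rewrite (_ : _ == j = false) ?scale0r//; apply: contra_neqF lj => /eqP e; exact/val_inj.
move=> l lj; rewrite /coef_derivative vf_apply_cst add0r.
rewrite (_ : _ == j = false) ?mulr0 ?scale0r//.
by apply: contra_neqF lj => /eqP e; exact/val_inj.
Qed.

(** With [k = (g_x - i g_y) / 2] the connection form on [phi j] is [i (j + 1) (g_x dy - g_y dx)],
    that is [i (j + 1)] times the Hodge dual of [dg]. Its exterior derivative is [i (j + 1)] times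
    the Laplacian of [g], times the area form. *)
Lemma potential_directions j s :
  potential k (VectorField (fun=> 1) (fun=> 1)) j s =
    ((- (j.+1%:R * 'D_('i%C : S) g s))%:C * 'i)%C /\
  potential k (VectorField (fun=> 'i%C) (fun=> - 'i%C)) j s =
    ((j.+1%:R * 'D_(1 : S) g s)%:C * 'i)%C.
Proof.
rewrite /potential /= kE /d_ds /d_ds_for !derive_real_complex// !scaleSE.
set x := 'D_1 g s; set y := 'D_('i) g s.
have natE : j.+1%:R = (j.+1%:R)%:C%C :> C by rewrite rmorph_nat.
split; rewrite {1}natE; move: (j.+1%:R : R) => l; apply/eqP; rewrite eq_complex /=.
  by apply/andP; split; apply/eqP; field.
by apply/andP; split; apply/eqP; field.
Qed.

Lemma laplacian_eq0 p : induced_from_hermitian_bundle (combinations phi) nabla ->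
  laplacian g p = 0.
Proof.
move=> [B [ht [nablat [hm [[_ _ nloc] _] [F [lF iF sF nF]]]]]].
have [U [X [FU [Up lt htE]]]] := hm p.
have [A [sA lA _ Aform]] := nloc U X FU lt.
have [oU _ lFU _] := lt.
pose u j t : realified X := FU (fiber_incl (F t (phi j t))).
pose P t := A (t, (1, 1)); pose Q t := A (t, ('i%C, - 'i%C)).
have phiG j : combinations phi (phi j).
  rewrite (basis_combination phi j); apply: combinations_combination => l.
  exact: smooth_fun_cst.
have FUZ s (c : C) (x : H s) : U s ->
    FU (fiber_incl (F s (c *: x))) = c *: (FU (fiber_incl (F s x)) : X) :> X.
  move=> Us; rewrite (linear_scale (lF s)).
  exact: (linear_scale (f := fun v : fiber B s => FU (fiber_incl v) : X) (lFU s Us)).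
have dA s v : U s -> differentiable (fun t => A (t, v)) s.
  move=> Us; have [dA [Ad _]] := sA 1%N.
  apply: (differentiable_comp (f := fun t : S => (t, v)) (g := A)).
    by apply: differentiable_pair; [exact: ex_diff|exact: differentiable_cst].
  by have [] := Ad (s, v).
have uE eta j s : smooth_vf eta -> U s ->
    vf_apply_vec eta (u j) s = (potential k eta j s *: (u j s : X) : realified X) -
      A (s, (vf_s eta s, vf_sbar eta s)) (u j s).
  move=> se Us; apply/eqP; rewrite eq_sym subr_eq eq_sym; apply/eqP.
  have := Aform eta _ s se (sF _ (phiG j)) Us.
  by rewrite nF// nabla_basis// FUZ.
(* This bound involves the connection of the bundle at [p] and no index [j]. *)
pose M := `|'D_('i%C : S) P p| + `|'D_(1 : S) Q p| + 2 * (`|P p| * `|Q p|).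
have bound j : `|j.+1%:R * laplacian g p| <= M.
  have AJ s v (x : realified X) : U s -> A (s, v) (mul_i X x) = mul_i X (A (s, v) x).
    by move=> Us; exact: (linear_scale (lA s v Us)).
  have scaleJ (r : R) (x : X) : (r%:C * 'i)%C *: x = r *: mul_i X x :> realified X.
    by rewrite -scalerA.
  apply: (curvature_le (u := u j)); [|exact/smooth_diff/smooth_derive/smooth_real_part..
    |exact: dA|exact: dA|by move=> x; exact: AJ|by move=> x; exact: AJ|].
    apply: filterS (open_nbhs_nbhs (conj oU Up)) => s Us; split.
    - exact: (trivialized_section_differentiable lt (sF _ (phiG j)) Us).
    - have [<- _] := real_directions (u j) s; rewrite uE//; last exact: smooth_vf_cst.
      by have [-> _] := potential_directions j s; rewrite scaleJ.
    - have [_ <-] := real_directions (u j) s; rewrite uE//; last exact: smooth_vf_cst.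
      by have [_ ->] := potential_directions j s; rewrite scaleJ.
  (* The trivialization is unitary and [F] isometric, so [u j p] has the norm of [phi j p]. *)
  rewrite -[LHS]/(Num.sqrt (complex.Re (inner (u j p : X) (u j p : X)))) -htE// iF.
  by rewrite (phi_basis p).1 eqxx sqrtr1.
apply/eqP; apply: contraT => lap0.
have nlap : 0 < `|laplacian g p| by rewrite normr_gt0.
have M0 : 0 <= M / `|laplacian g p|.
  by rewrite divr_ge0// (le_trans (normr_ge0 _) (bound 0%N)).
have := archi_boundP M0; set n := Num.bound _; rewrite ltr_pdivrMr// ltNge => /negP[].
by apply: le_trans (bound n); rewrite normrM normr_nat ler_wpM2r// ler_nat leqnSn.
Qed.

End example_not_induced.

Theorem lemma2p1 (R : realType) (H : Rcomplex R -> hilbertType R)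
    (phi : nat -> hsection H) (k : Rcomplex R -> R[i]) :
  (forall s, infinite_dimensional (H s)) ->
  (forall s, separable_space (realified (H s))) ->
  (forall s, orthonormal_basis (fun j => phi j s)) ->
  (forall s, analytic_at k s) ->
  (exists nabla, combination_derivative phi k nabla) /\
  forall nabla, combination_derivative phi k nabla ->
  [/\ smooth_structure (combinations phi) nabla,
      forall j, analytic_section (combinations phi) nabla (phi j),
      analytic_hilbert_field (combinations phi) nabla &
      forall g : Rcomplex R -> R,
        (forall s, analytic_at (fun t => (g t)%:C) s) ->
        ~ harmonic g ->
        (forall s, k s = d_ds (fun t => (g t)%:C) s) ->
        ~ induced_from_hermitian_bundle (combinations phi) nabla].
Proof.
move=> _ _ basis ak; have sk := analytic_smooth ak.
split; first exact: exists_combination_derivative.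
move=> nabla nablaE; split.
- exact: example_smooth_structure.
- move=> j; rewrite (basis_combination phi j).
  exact: (constant_combination_analytic basis sk nablaE).
- move=> s; apply: (combinations_dense_subset basis) => N c.
  exact: constant_combination_analytic.
- move=> g ag nh kE induced; have sg := analytic_smooth ag.
  (* [harmonic] also asks for class C^2, which the analyticity of [g] provides. *)
  apply: nh; split; first exact: smooth_real_part.
  by move=> p; exact: (laplacian_eq0 basis nablaE sg kE p induced).
Qed.
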